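(* Let $H$, $\{e_j\}_{j\in\mathbb{Z}}$, $P_m$, $\mathcal{C}$, $\mathcal{A}=l_2(\mathcal{C})$, $\mathcal{U}$, $\{W_j\}_{j\in\mathbb{Z}}$ and $T$ be as in the context. Then the following statements are equivalent. (1) The set of periodic elements of $T$ is dense in $\mathcal{A}$. (2) There exists a dense subset $\mathcal{D}$ of $\mathcal{A}$ such that for each $J,m\in\mathbb{N}$ and each $\{D_j\}_{j\in\mathbb{Z}}\in\mathcal{D}$ there exists some $d\in\mathbb{N}$ with $d>2m$ such that $$\lim_{\widetilde{m}\to\infty}\Big(\sup_{n\in\mathbb{N},\,n\ge\widetilde{m}}\big\|W_{r+nd}\,W_{r+nd-1}\cdots W_{r+1}\,D_r\,P_m\big\|\Big)=0$$ and $$\lim_{\widetilde{m}\to\infty}\Big(\sup_{n\in\mathbb{N},\,n\ge\widetilde{m}}\big\|W_{r+1-nd}^{-1}\,W_{r+2-nd}^{-1}\cdots W_{r}^{-1}\,D_r\,P_m\big\|\Big)=0$$ for each $r\in\{-J,-J+1,\dots,J-1,J\}$.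
   Context: $\mathbb{N}=\{1,2,3,\dots\}$. $H$ is a separable Hilbert space with an orthonormal basis $\{e_j\}_{j\in\mathbb{Z}}$ indexed by $\mathbb{Z}$; $B(H)$ is the algebra of bounded linear operators on $H$, and $\mathcal{C}$ is the $C^*$-algebra of compact operators on $H$. For $m\in\mathbb{N}$, $P_m$ is the orthogonal projection onto $\mathrm{Span}\{e_{-m},\dots,e_m\}$. $\mathcal{U}$ is the unitary operator on $H$ with $\mathcal{U}e_j=e_{j+1}$ for all $j\in\mathbb{Z}$. $\mathcal{A}=l_2(\mathcal{C})$ is the standard (right) Hilbert module over $\mathcal{C}$: the space of sequences $\{x_j\}_{j\in\mathbb{Z}}$ in $\mathcal{C}$ such that $\sum_{j\in\mathbb{Z}}x_j^*x_j$ converges in norm in $\mathcal{C}$, with norm $\|\{x_j\}\|=\big\|\sum_{j\in\mathbb{Z}}x_j^*x_j\big\|^{1/2}$; it is a (non-unital) Banach algebra under coordinatewise multiplication. $\mathcal{A}_1$ is the unital Banach algebra of uniformly norm-bounded sequences $\{y_j\}_{j\in\mathbb{Z}}$ in $B(H)$ with coordinatewise multiplication and norm $\|\{y_j\}\|_1=\sup_j\|y_j\|$. The map $\Phi:\mathcal{A}_1\to\mathcal{A}_1$ is defined by $\Phi(\{y_j\}_{j\in\mathbb{Z}})=\{\mathcal{U}^*y_{j-1}\,\mathcal{U}\}_{j\in\mathbb{Z}}$; it restricts to an isometric isomorphism of $\mathcal{A}$. $\{W_j\}_{j\in\mathbb{Z}}$ is a sequence of invertible operators in $B(H)$ such that $\{W_j\}$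 and $\{W_j^{-1}\}$ are both uniformly bounded in norm. Put $b=\{W_j\,\mathcal{U}\}_{j\in\mathbb{Z}}$, which is an invertible element of $\mathcal{A}_1$, and let $T:\mathcal{A}\to\mathcal{A}$ be $T(a)=b\,\Phi(a)$, i.e. $(T(a))_j=W_j\,a_{j-1}\,\mathcal{U}$ for all $j\in\mathbb{Z}$. An element $x\in\mathcal{A}$ is a periodic element of $T$ if there exists $d\in\mathbb{N}$ such that $T^{nd}(x)=x$ for all $n\in\mathbb{N}$. *)

(* Defs.v *)
From HB Require Import structures.
From mathcomp Require Import all_boot all_order all_algebra.
From mathcomp Require Import complex finmap.
From mathcomp Require Import all_classical all_reals all_analysis.
From mathcomp.analysis Require showcase.summability.

Set Implicit Arguments.
Unset Strict Implicit.
Unset Printing Implicit Defensive.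
Import Order.TTheory GRing.Theory Num.Theory numFieldNormedType.Exports.

Local Open Scope classical_set_scope.
Local Open Scope ring_scope.
Local Open Scope complex_scope.

(* The library norm of a complex normed module takes its values in R[i]; they
   are real and nonnegative, and [rnorm] is that norm as an element of R. *)
Definition rnorm (R : realType) (V : normedModType R[i]) (x : V) : R :=
  complex.Re `|x|.

Lemma rnormE (R : realType) (V : normedModType R[i]) (x : V) :
  `|x| = (rnorm x)%:C.
Proof. by rewrite /rnorm RRe_real // normr_real. Qed.

Section RNorm.
Variables (R : realType) (V : normedModType R[i]).
Implicit Types x y : V.

Lemma rnorm_ge0 x : 0 <= rnorm x.
Proof. by rewrite -lecR -rnormE normr_ge0. Qed.

Lemma rnorm0 : rnorm (0 : V) = 0.
Proof. by rewrite /rnorm normr0. Qed.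

Lemma rnorm_eq0 x : rnorm x = 0 -> x = 0.
Proof. by move=> x0; apply/normr0_eq0; rewrite rnormE x0. Qed.

Lemma rnormD x y : rnorm (x + y) <= rnorm x + rnorm y.
Proof. by rewrite -lecR rmorphD /= -!rnormE ler_normD. Qed.

Lemma rnormN x : rnorm (- x) = rnorm x.
Proof. by rewrite /rnorm normrN. Qed.

Lemma rnormZ (l : R[i]) x : rnorm (l *: x) = complex.Re `|l| * rnorm x.
Proof.
apply: complexI; rewrite rmorphM /= -!rnormE normrZ.
by case: l.
Qed.

End RNorm.

Section BoundedOperators.
Variables (R : realType) (H : normedModType R[i]).

Record bop := Bop {
  bop_fun :> H -> H;
  bop_linear : linear bop_fun;
  bop_bounded : exists M : R, forall x, rnorm (bop_fun x) <= M * rnorm x }.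

Implicit Types A B : bop.

Lemma bopP A B : A =1 B -> A = B.
Proof.
case: A B => [f fl fb] [g gl gb] /= /funext fg; subst g.
by congr Bop; exact: Prop_irrelevance.
Qed.

Lemma bopB A : {morph A : x y / x - y}.
Proof. by move=> x y; rewrite addrC -scaleN1r (bop_linear A) scaleN1r addrC. Qed.

Lemma bop0 A : A 0 = 0.
Proof. by rewrite -[X in A X](subrr 0) bopB subrr. Qed.

Lemma bopZ A (l : R[i]) x : A (l *: x) = l *: A x.
Proof. by rewrite -[l *: x]addr0 (bop_linear A) bop0 addr0. Qed.

Lemma bopD A x y : A (x + y) = A x + A y.
Proof. by rewrite -[x in LHS]scale1r (bop_linear A) scale1r. Qed.

HB.instance Definition _ := gen_eqMixin bop.
HB.instance Definition _ := gen_choiceMixin bop.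

Program Definition bop_zero := @Bop (fun=> 0) _ _.
Next Obligation. by move=> a x y; rewrite scaler0 addr0. Qed.
Next Obligation. by exists 0 => x; rewrite rnorm0 mul0r. Qed.

Program Definition bop_one := @Bop id _ _.
Next Obligation. by []. Qed.
Next Obligation. by exists 1 => x; rewrite mul1r. Qed.

Program Definition bop_opp A := @Bop (fun x => - A x) _ _.
Next Obligation.
by move=> A a x y; rewrite (bop_linear A) opprD scalerN.
Qed.
Next Obligation.
by move=> A; case: (bop_bounded A) => M AM; exists M => x; rewrite rnormN.
Qed.

Program Definition bop_add A B := @Bop (fun x => A x + B x) _ _.
Next Obligation.
by move=> A B a x y; rewrite !bop_linear scalerDr addrACA.
Qed.
Next Obligation.
move=> A B; case: (bop_bounded A) (bop_bounded B) => M AM [N BN].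
by exists (M + N) => x; rewrite mulrDl (le_trans (rnormD _ _)) ?lerD.
Qed.

Program Definition bop_scale (l : R[i]) A := @Bop (fun x => l *: A x) _ _.
Next Obligation.
by move=> l A a x y; rewrite bop_linear scalerDr !scalerA mulrC.
Qed.
Next Obligation.
move=> l A; case: (bop_bounded A) => M AM.
exists (complex.Re `|l| * M) => x; rewrite rnormZ -mulrA ler_wpM2l //.
by rewrite -lecR RRe_real ?normr_real // normr_ge0.
Qed.

Program Definition bop_mul A B := @Bop (A \o B) _ _.
Next Obligation. by move=> A B a x y; rewrite /= !bop_linear. Qed.
Next Obligation.
move=> A B; case: (bop_bounded A) (bop_bounded B) => M AM [N BN].
exists (`|M| * N) => x /=; rewrite (le_trans (AM _)) // -mulrA.
rewrite (le_trans (ler_wpM2r (rnorm_ge0 _) (ler_norm M))) //.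
by rewrite ler_wpM2l.
Qed.

Lemma bop_addA : associative bop_add.
Proof. by move=> A B C; apply: bopP => x; rewrite /= addrA. Qed.
Lemma bop_addC : commutative bop_add.
Proof. by move=> A B; apply: bopP => x; rewrite /= addrC. Qed.
Lemma bop_add0 : left_id bop_zero bop_add.
Proof. by move=> A; apply: bopP => x; rewrite /= add0r. Qed.
Lemma bop_addN : left_inverse bop_zero bop_opp bop_add.
Proof. by move=> A; apply: bopP => x; rewrite /= addNr. Qed.

HB.instance Definition _ :=
  GRing.isZmodule.Build bop bop_addA bop_addC bop_add0 bop_addN.

Lemma bop_mulA : associative bop_mul.
Proof. by move=> A B C; apply: bopP. Qed.
Lemma bop_mul1l : left_id bop_one bop_mul.
Proof. by move=> A; apply: bopP. Qed.
Lemma bop_mul1r : right_id bop_one bop_mul.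
Proof. by move=> A; apply: bopP. Qed.
Lemma bop_mulDl : left_distributive bop_mul bop_add.
Proof. by move=> A B C; apply: bopP. Qed.
Lemma bop_mulDr : right_distributive bop_mul bop_add.
Proof. by move=> A B C; apply: bopP => x; rewrite /= bopD. Qed.

(* The product of the ring [bop] is composition: [(A * B) x = A (B x)]. *)
HB.instance Definition _ := GRing.Zmodule_isPzRing.Build bop
  bop_mulA bop_mul1l bop_mul1r bop_mulDl bop_mulDr.

Lemma bop_scaleA (a b : R[i]) A :
  bop_scale a (bop_scale b A) = bop_scale (a * b) A.
Proof. by apply: bopP => x; rewrite /= scalerA. Qed.
Lemma bop_scale1 : left_id 1 bop_scale.
Proof. by move=> A; apply: bopP => x; rewrite /= scale1r. Qed.
Lemma bop_scaleDr : right_distributive bop_scale +%R.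
Proof. by move=> a A B; apply: bopP => x; rewrite /= scalerDr. Qed.
Lemma bop_scaleDl A : {morph bop_scale^~ A : a b / a + b}.
Proof. by move=> a b; apply: bopP => x; rewrite /= scalerDl. Qed.

HB.instance Definition _ := GRing.Zmodule_isLmodule.Build R[i] bop
  bop_scaleA bop_scale1 bop_scaleDr bop_scaleDl.

Definition opnorm A : R := sup [set rnorm (A x) | x in [set x | rnorm x <= 1]].

Lemma opnorm_has_sup A :
  has_sup [set rnorm (A x) | x in [set x | rnorm x <= 1]].
Proof.
split; first by exists (rnorm (A 0)), 0; rewrite //= rnorm0.
have [M AM] := bop_bounded A; exists `|M| => _ [x /= x1 <-].
rewrite (le_trans (AM _)) // (le_trans (ler_wpM2r (rnorm_ge0 _) (ler_norm M))) //.
by rewrite ler_piMr.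
Qed.

Lemma opnorm_ub A x : rnorm x <= 1 -> rnorm (A x) <= opnorm A.
Proof. by move=> x1; apply: (ub_le_sup (opnorm_has_sup A).2); exists x. Qed.

Lemma opnorm_le A (c : R) :
  (forall x, rnorm x <= 1 -> rnorm (A x) <= c) -> opnorm A <= c.
Proof.
by move=> Ac; apply: ge_sup; [case: (opnorm_has_sup A)|move=> _ [x /= ? <-]; exact: Ac].
Qed.

Lemma opnorm_ge0 A : 0 <= opnorm A.
Proof. by rewrite (le_trans (rnorm_ge0 (A 0))) ?opnorm_ub ?rnorm0. Qed.

Lemma opnormP A x : rnorm (A x) <= opnorm A * rnorm x.
Proof.
have [x0|x0] := eqVneq (rnorm x) 0.
  by rewrite (rnorm_eq0 x0) bop0 rnorm0 mulr0.
have xgt0 : 0 < rnorm x by rewrite lt0r x0 rnorm_ge0.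
have E (y : H) : rnorm ((rnorm x)^-1%:C *: y) = (rnorm x)^-1 * rnorm y.
  rewrite rnormZ ger0_norm ?lecR ?invr_ge0 ?rnorm_ge0 //.
rewrite -ler_pdivrMr // mulrC -E -bopZ; apply: opnorm_ub.
by rewrite E mulVf.
Qed.

Definition bop_norm A : R[i] := (opnorm A)%:C.

Lemma bop_normD A B : bop_norm (A + B) <= bop_norm A + bop_norm B.
Proof.
rewrite /bop_norm -rmorphD lecR; apply: opnorm_le => x x1.
by rewrite (le_trans (rnormD _ _)) // lerD // opnorm_ub.
Qed.

Lemma opnormZ_le (l : R[i]) A : opnorm (l *: A) <= complex.Re `|l| * opnorm A.
Proof.
apply: opnorm_le => x x1; rewrite rnormZ ler_wpM2l ?opnorm_ub //.
by rewrite -lecR RRe_real ?normr_real // normr_ge0.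
Qed.

Lemma bop_normZ (l : R[i]) A : bop_norm (l *: A) = `|l| * bop_norm A.
Proof.
have le (k : R[i]) (B : bop) : bop_norm (k *: B) <= `|k| * bop_norm B.
  have -> : `|k| = (complex.Re `|k|)%:C by case: k.
  by rewrite /bop_norm -rmorphM lecR opnormZ_le.
apply/eqP; rewrite eq_le le andTb.
have [->|l0] := eqVneq l 0.
  by rewrite normr0 mul0r lecR opnorm_ge0.
rewrite mulrC -ler_pdivlMr ?normr_gt0 // mulrC -normfV.
by rewrite -{1}[A](scalerK l0) le.
Qed.

Lemma bop_norm_eq0 A : bop_norm A = 0 -> A = 0.
Proof.
move=> /complexI A0; apply: bopP => x; apply: rnorm_eq0.
by apply/eqP; rewrite eq_le rnorm_ge0 andbT (le_trans (opnormP _ _)) // A0 mul0r.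
Qed.

HB.instance Definition _ := Lmodule_isNormed.Build R[i] bop
  bop_normD bop_normZ bop_norm_eq0.

Lemma rnorm_bopE A : rnorm A = opnorm A.
Proof. by reflexivity. Qed.

Definition compact_operator A : Prop :=
  precompact [set A x | x in [set x | rnorm x <= 1]].

End BoundedOperators.

Section HilbertSpace.
Variables (R : realType) (H : completeNormedModType R[i]).
Variable dot : {dot H for Num.conj}.

(* [H], which is complete, is a Hilbert space for [dot]; [dot] is linear in its
   first argument. *)
Definition hilbert_norm : Prop := forall x : H, `|x| ^+ 2 = dot x x.

(* The adjoint exists and is unique by the Riesz representation theorem, so that
   the default value of [xget] is never used on a Hilbert space. *)
Definition adjoint (A : bop H) : bop H :=
  xget 0 [set B : bop H | forall x y, dot (A x) y = dot x (B y)].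

Definition unitary_op (A : bop H) : Prop :=
  adjoint A * A = 1 /\ A * adjoint A = 1.

Definition span_of (I : Type) (v : I -> H) (J : set I) : set H :=
  [set x | exists n (c : 'I_n -> R[i]) (i : 'I_n -> I),
     (forall k, J (i k)) /\ x = \sum_(k < n) c k *: v (i k)].

Definition orthonormal_family (I : eqType) (v : I -> H) : Prop :=
  forall i j, dot (v i) (v j) = (i == j)%:R.

Definition orthonormal_basis (I : eqType) (v : I -> H) : Prop :=
  orthonormal_family v /\ closure (span_of v setT) = setT.

Definition orthogonal_projection (Q : bop H) (S : set H) : Prop :=
  forall x, S (Q x) /\ (forall y, S y -> dot (x - Q x) y = 0).

Notation opseq := (int -> bop H).

(* Sums over int are limits, in operator norm, along the net of finite subsets
   of int. *)
Definition gram_seq (x : opseq) : opseq := fun j => adjoint (x j) * x j.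

Definition l2C : set opseq :=
  [set x | (forall j, compact_operator (x j)) /\
     cvg (summability.partial_sum (gram_seq x) @ summability.totally)].

Definition l2norm (x : opseq) : R :=
  Num.sqrt (rnorm (summability.sum (gram_seq x))).

Definition l2_dense (D : set opseq) : Prop :=
  D `<=` l2C /\
  forall a, l2C a -> forall eps : R, 0 < eps ->
    exists2 x, D x & l2norm (fun j => x j - a j) < eps.

Definition seqmul (x y : opseq) : opseq := fun j => x j * y j.

Definition Phi (U : bop H) (y : opseq) : opseq :=
  fun j => adjoint U * y (j - 1) * U.

Definition weighted_shift (U : bop H) (W : opseq) (a : opseq) : opseq :=
  seqmul (fun j => W j * U) (Phi U a).

Lemma weighted_shiftE U W a j : unitary_op U ->
  weighted_shift U W a j = W j * a (j - 1) * U.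
Proof.
move=> [_ UU]; rewrite /weighted_shift /seqmul /Phi !mulrA.
by rewrite -(mulrA (W j)) UU mulr1.
Qed.

Definition periodic_elements (T : opseq -> opseq) : set opseq :=
  [set x | l2C x /\ exists2 d, (0 < d)%N &
     forall n, (0 < n)%N -> iter (n * d) T x = x].

(* W_{r+k} W_{r+k-1} ... W_{r+1} *)
Definition prod_above (W : opseq) (r : int) (k : nat) : bop H :=
  \prod_(i < k) W (r + k%:Z - i%:Z).

(* V_{r+1-k} V_{r+2-k} ... V_r *)
Definition prod_below (V : opseq) (r : int) (k : nat) : bop H :=
  \prod_(i < k) V (r + 1 - k%:Z + i%:Z).

(* The supremum is taken in \bar R because it need not be finite. *)
Definition tail_sup_cvg0 (A : nat -> bop H) : Prop :=
  (fun m => ereal_sup [set (rnorm (A n))%:E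
                      | n in [set n | (0 < n)%N /\ (m <= n)%N]])
    @ \oo --> 0%E.

End HilbertSpace.

(* Main.v *)
(** The operators [W_j] are the transition maps of a gauge: there are invertible
    [G_j] with [W_j = G_j G_{j-1}^-1], so that
    [(T^n a)_j = G_j G_{j-n}^-1 a_{j-n} U^n], and the two products of the statement
    are [G_{r+nd} G_r^-1] and [G_{r-nd} G_r^-1].  If [x] is [d]-periodic, these
    products applied to [x_r] are therefore [x_{r+nd}] and [x_{r-nd}] up to a
    unitary, and the entries of an element of [l_2(C)] tend to [0].  Conversely,
    truncate [x] in [D] to [x_r P_m] for [|r| <= J <= m], replace [d] by a large
    multiple [N d], and sum over its whole orbit under [T^(N d)].  The gap [d > 2m]
    makes the blocks [P_m U^{kNd}] orthogonal, so the norm of the orbit sum away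
    from [k = 0] is controlled by the largest norm of its entries, not by their
    sum.  Norms in [l_2(C)] are handled through
    [|x|^2 = sup_{|v| <= 1} sum_j |x_j v|^2]. *)

Require Import Defs.
From HB Require Import structures.
From mathcomp Require Import all_boot all_order all_algebra.
From mathcomp Require Import complex finmap.
From mathcomp Require Import all_classical all_reals all_analysis.
From mathcomp.analysis Require showcase.summability.
From mathcomp Require Import ring lra zify.

Set Implicit Arguments.
Unset Strict Implicit.
Unset Printing Implicit Defensive.
Import Order.TTheory GRing.Theory Num.Theory numFieldNormedType.Exports.

Local Open Scope classical_set_scope.
Local Open Scope ring_scope.
Local Open Scope complex_scope.

(** * Real inner product and adjoints *)

Section RealNorm.
Variables (R : realType) (V : normedModType R[i]).
Implicit Types x y : V.

Lemma rnormB x y : rnorm (x - y) = rnorm (y - x).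
Proof. by rewrite -rnormN opprB. Qed.

Lemma rnormBD x y : rnorm (x - y) <= rnorm x + rnorm y.
Proof. by rewrite -[leRHS]/(_ + _) -(rnormN y) rnormD. Qed.

Lemma rnormZr (r : R) x : rnorm (r%:C *: x) = `|r| * rnorm x.
Proof. by rewrite rnormZ normc_def /= expr0n addr0 sqrtr_sqr. Qed.

Lemma ltc0_real (e : R[i]) : 0 < e -> exists2 r : R, 0 < r & e = r%:C.
Proof.
case: e => a b; rewrite ltcE /= => /andP[/eqP -> a0].
by exists a.
Qed.

Lemma cvg_rnormP T (F : set_system T) {FF : Filter F} (f : T -> V) (l : V) :
  f @ F --> l <->
  forall eps : R, 0 < eps -> \forall t \near F, rnorm (f t - l) <= eps.
Proof.
split=> [/cvgrPdist_le fl eps eps0|fl].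
  have /fl : 0 < eps%:C by rewrite ltcR.
  by apply: filterS => t; rewrite rnormE lecR rnormB.
apply/cvgrPdist_le => _ /ltc0_real[eps eps0 ->].
by have := fl _ eps0; apply: filterS => t; rewrite rnormE lecR rnormB.
Qed.

End RealNorm.

Lemma cauchy_rnorm_cvg (R : realType) (V : completeNormedModType R[i]) T
    (F : set_system T) {FF : ProperFilter F} (f : T -> V) :
  (forall eps : R, 0 < eps -> exists2 S, F S &
     forall s t, S s -> S t -> rnorm (f s - f t) <= eps) ->
  exists l : V, f @ F --> l.
Proof.
move=> fC; suff /cauchy_cvgP : cauchy (f @ F) by move=> fF; exists (lim (f @ F)).
apply: cauchy_exP => _ /ltc0_real[eps eps0 ->].
have [|S FS CS] := fC (eps / 2); first by rewrite divr_gt0.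
have [s Ss] := filter_ex FS.
exists (f s); change (F [set t | ball (f s) eps%:C (f t)]).
apply: filterS FS => t St.
rewrite -ball_normE /= rnormE ltcR (le_lt_trans (CS _ _ Ss St)) //.
lra.
Qed.

Section RealInnerProduct.
Variables (R : realType) (H : completeNormedModType R[i]).
Variable dot : {dot H for Num.conj}.
Hypothesis H_hilbert : hilbert_norm dot.
Implicit Types (x y z u v : H) (r : R).

Definition rdot x y : R := complex.Re (dot x y).

Lemma dotC x y : dot x y = (dot y x)^*%C.
Proof. by rewrite hermC expr0 mul1r. Qed.

Lemma rdotC x y : rdot x y = rdot y x.
Proof. by rewrite /rdot dotC; case: (dot y x). Qed.

Lemma rdotDl x y z : rdot (x + y) z = rdot x z + rdot y z.
Proof. by rewrite /rdot linearDl raddfD. Qed.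

Lemma rdotNl x y : rdot (- x) y = - rdot x y.
Proof. by rewrite /rdot linearNl raddfN. Qed.

Lemma rdotBl x y z : rdot (x - y) z = rdot x z - rdot y z.
Proof. by rewrite rdotDl rdotNl. Qed.

Lemma rdotZl r x y : rdot (r%:C *: x) y = r * rdot x y.
Proof.
rewrite /rdot linearZl_LR /=; case: (dot x y) => a b /=.
by rewrite mul0r subr0.
Qed.

Lemma rdotDr x y z : rdot z (x + y) = rdot z x + rdot z y.
Proof. by rewrite rdotC rdotDl !(rdotC z). Qed.

Lemma rdotNr x y : rdot y (- x) = - rdot y x.
Proof. by rewrite rdotC rdotNl rdotC. Qed.

Lemma rdotBr x y z : rdot z (x - y) = rdot z x - rdot z y.
Proof. by rewrite rdotDr rdotNr. Qed.

Lemma rdotZr r x y : rdot y (r%:C *: x) = r * rdot y x.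
Proof. by rewrite rdotC rdotZl rdotC. Qed.

Lemma rnorm_sqr x : rnorm x ^+ 2 = rdot x x.
Proof.
apply: complexI; rewrite rmorphXn /= -rnormE H_hilbert /rdot RRe_real //.
by rewrite -H_hilbert realX ?normr_real.
Qed.

Lemma rnorm_sqrD x y :
  rnorm (x + y) ^+ 2 = rnorm x ^+ 2 + 2 * rdot x y + rnorm y ^+ 2.
Proof.
rewrite !rnorm_sqr !rdotDl !rdotDr (rdotC y x); ring.
Qed.

Lemma rnorm_sqrB x y :
  rnorm (x - y) ^+ 2 = rnorm x ^+ 2 - 2 * rdot x y + rnorm y ^+ 2.
Proof. by rewrite rnorm_sqrD rdotNr rnormN; ring. Qed.

Lemma rnorm_sqrD_le x y :
  rnorm (x + y) ^+ 2 <= 2 * rnorm x ^+ 2 + 2 * rnorm y ^+ 2.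
Proof.
have := sqr_ge0 (rnorm (x - y)); rewrite rnorm_sqrB rnorm_sqrD; lra.
Qed.

Lemma rdot_le x y : 2 * rdot x y <= rnorm x ^+ 2 + rnorm y ^+ 2.
Proof. have := sqr_ge0 (rnorm (x - y)); rewrite rnorm_sqrB; lra. Qed.

Lemma rdot_cauchy_schwarz x y : rdot x y <= rnorm x * rnorm y.
Proof.
have [->|x0] := eqVneq x 0.
  by rewrite /rdot linear0l rnorm0 mul0r.
have [->|y0] := eqVneq y 0.
  by rewrite /rdot linear0r rnorm0 mulr0.
have nz u : u != 0 -> 0 < rnorm u.
  by move=> u0; rewrite lt0r rnorm_ge0 andbT; apply: contra u0 => /eqP/rnorm_eq0 ->.
have := rdot_le ((rnorm x)^-1%:C *: x) ((rnorm y)^-1%:C *: y).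
rewrite rdotZl rdotZr !rnormZr !ger0_norm ?invr_ge0 ?rnorm_ge0 //.
rewrite !mulVf ?gt_eqF ?nz // expr1n => h.
have : (rnorm x)^-1 * ((rnorm y)^-1 * rdot x y) <= 1 by lra.
by rewrite mulrA -invfM mulrC ler_pdivrMr ?mul1r // mulr_gt0 ?nz.
Qed.

Lemma rdot_eq0 u : (forall x, rdot x u = 0) -> u = 0.
Proof.
by move=> /(_ u); rewrite -rnorm_sqr => /eqP; rewrite sqrf_eq0 => /eqP/rnorm_eq0.
Qed.

Lemma dot_rdotP u v : (forall x, rdot x u = rdot x v) -> u = v.
Proof.
move=> uv; apply/eqP; rewrite -subr_eq0; apply/eqP/rdot_eq0 => x.
by rewrite rdotBr uv subrr.
Qed.

Lemma Im_dot x y : complex.Im (dot x y) = rdot (- 'i *: x) y.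
Proof.
by rewrite /rdot linearZl_LR /=; case: (dot x y) => a b /=; ring.
Qed.

(* The Riesz vector of [f] minimises [rnorm x ^+ 2 - 2 * f x]. *)
Lemma riesz_real (f : H -> R) (M : R) :
  {morph f : x y / x + y} -> (forall r x, f (r%:C *: x) = r * f x) ->
  (forall x, `|f x| <= M * rnorm x) ->
  exists z, forall x, f x = rdot x z.
Proof.
move=> fD fZ fM; pose g x : R := rnorm x ^+ 2 - 2 * f x.
have g_ge x : - M ^+ 2 <= g x.
  have := fM x; have := ler_norm (f x); have := sqr_ge0 (rnorm x - M).
  rewrite /g !expr2; nra.
have para x y : rnorm (x - y) ^+ 2 = 2 * g x + 2 * g y -
    4 * g ((2^-1)%:C *: (x + y)).
  rewrite /g fZ fD rnormZr ger0_norm ?invr_ge0 ?ler0n // exprMn.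
  rewrite rnorm_sqrB rnorm_sqrD; field.
  by [].
have n0 n : 0 < n.+1%:R^-1 :> R by rewrite invr_gt0.
have [I [g_inf app]] : exists I : R, (forall x, I <= g x) /\
    (forall n, exists x, g x < I + n.+1%:R^-1).
  pose E := [set - g x | x in [set: H]].
  have supE : has_sup E.
    split; first by exists (- g 0), 0.
    by exists (M ^+ 2) => _ [x _ <-]; rewrite lerNl g_ge.
  exists (- sup E); split=> [x|n].
    by rewrite lerNl; apply: (ub_le_sup supE.2); exists x.
  have [w [x' _ <-]] := sup_adherent (n0 n) supE.
  by exists x'; rewrite -ltrN2 opprD opprK.
have [s sP] := choice app.
have sC n m : rnorm (s n - s m) ^+ 2 <= 2 * (n.+1%:R^-1 + m.+1%:R^-1).
  rewrite para; have := sP n; have := sP m.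
  have := g_inf ((2^-1)%:C *: (s n + s m)).
  by move: n.+1%:R^-1 m.+1%:R^-1 => A B; lra.
have [|z sz] := @cauchy_rnorm_cvg R H nat \oo _ s.
  move=> eps eps0.
  have e4 : 0 < eps ^+ 2 / 4 by rewrite divr_gt0 ?exprn_gt0.
  have [N _ NP] := near_infty_natSinv_lt (PosNum e4).
  exists [set n | (N <= n)%N]; first exact: nbhs_infty_ge.
  move=> n m /NP /= hn /NP /= hm.
  rewrite -(@ler_pXn2r _ 2) ?nnegrE ?rnorm_ge0 ?(ltW eps0) //.
  apply: le_trans (sC _ _) _; move: hn hm; move: n.+1%:R^-1 m.+1%:R^-1 => A B; lra.
have gz x : g z <= g x.
  apply: le_trans (g_inf x); apply/ler_addgt0Pr => eps eps0.
  pose K := rnorm z + `|M| + 1.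
  have K0 : 0 < K by rewrite ltr_wpDl // addr_ge0 ?rnorm_ge0.
  have e2 : 0 < eps / 2 by rewrite divr_gt0.
  have e4 : 0 < eps / (4 * K) by rewrite divr_gt0 // mulr_gt0.
  have /cvg_rnormP/(_ _ e4) sze := sz.
  have [n [nz /= nlt]] := filter_ex (filterI sze (near_infty_natSinv_lt (PosNum e2))).
  have h1 : g z - g (s n) = 2 * rdot z (z - s n) - rnorm (z - s n) ^+ 2
      - 2 * f (z - s n).
    rewrite /g rnorm_sqrB rdotBr -rnorm_sqr.
    have -> : f (z - s n) = f z - f (s n).
      rewrite fD; have := fZ (-1) (s n).
      by rewrite rmorphN1 scaleN1r mulN1r => ->.
    ring.
  have h2 := rdot_cauchy_schwarz z (z - s n).
  have h3 := fM (z - s n); have := ler_norm (- f (z - s n)); rewrite normrN => h4.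
  have h5 := ler_wpM2r (rnorm_ge0 (z - s n)) (ler_norm M).
  have h6 : K * rnorm (z - s n) <= eps / 4.
    rewrite rnormB -ler_pdivlMl //; apply: le_trans nz _.
    by rewrite [leRHS]mulrC -mulrA -invfM.
  have := sP n; have := sqr_ge0 (rnorm (z - s n)); have := rnorm_ge0 (z - s n).
  move: h6 nlt; rewrite /K !mulrDl mul1r.
  by move: n.+1%:R^-1 => A; lra.
exists z => x; apply/eqP; rewrite -subr_eq0 -sqrf_eq0 eq_le sqr_ge0 andbT.
set c := _ - _; have xx0 := sqr_ge0 (rnorm x).
set a := rnorm x ^+ 2 in xx0.
have vari t : 0 <= t ^+ 2 * a - 2 * t * c.
  have := gz (z + t%:C *: x).
  rewrite /g rnorm_sqrD rnormZr rdotZr fD fZ exprMn real_normK ?num_real // (rdotC z) /c /a.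
  by rewrite -subr_ge0; congr (0 <= _); ring.
have := vari (c / (a + 1)).
have a1 : 0 < a + 1 by rewrite ltr_wpDl.
have -> : (c / (a + 1)) ^+ 2 * a - 2 * (c / (a + 1)) * c =
   - (c ^+ 2 * ((a + 2) / (a + 1) ^+ 2)) by field; rewrite gt_eqF.
rewrite oppr_ge0 pmulr_lle0 // divr_gt0 ?exprn_gt0 //; lra.
Qed.

Lemma adjoint_exists (A : bop H) :
  exists B : bop H, forall x y, dot (A x) y = dot x (B y).
Proof.
have dot_re x y z : (forall x, rdot (A x) y = rdot x z) -> dot (A x) y = dot x z.
  move=> h; apply/eqP; rewrite eq_complex; apply/andP; split; first exact/eqP/h.
  by rewrite !Im_dot -bopZ h.
have ex y : exists z, forall x, rdot (A x) y = rdot x z.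
  apply: (riesz_real (M := opnorm A * rnorm y)) => [x x'|r x|x].
  - by rewrite bopD rdotDl.
  - by rewrite bopZ rdotZl.
  have := rdot_cauchy_schwarz (A x) y; have := rdot_cauchy_schwarz (A (- x)) y.
  have -> : A (- x) = - A x by rewrite -[in LHS]sub0r bopB bop0 sub0r.
  rewrite rdotNl rnormN ler_norml => h1 h2.
  have := ler_wpM2r (rnorm_ge0 y) (opnormP A x); lra.
have [B BP] := choice ex.
have BE x y : dot (A x) y = dot x (B y) by apply: dot_re.
have Blin : linear B.
  move=> a u v; apply: dot_rdotP => x; rewrite /rdot -BE.
  rewrite linearDr linearZr_LR /= 2!BE.
  by rewrite [in RHS]linearDr linearZr_LR.
have Bbd : exists M : R, forall x, rnorm (B x) <= M * rnorm x.
  exists (opnorm A) => x.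
  have [->|Bx0] := eqVneq (rnorm (B x)) 0; first by rewrite mulr_ge0 ?opnorm_ge0 ?rnorm_ge0.
  rewrite -(@ler_pM2l _ (rnorm (B x))) ?lt0r ?Bx0 ?rnorm_ge0 //.
  rewrite -expr2 rnorm_sqr -BP (le_trans (rdot_cauchy_schwarz _ _)) //.
  have := ler_wpM2r (rnorm_ge0 x) (opnormP A (B x)); lra.
by exists (Bop Blin Bbd).
Qed.

Lemma adjointP (A : bop H) x y : dot (A x) y = dot x (adjoint dot A y).
Proof.
move: x y; rewrite /adjoint; case: xgetP => [//|h].
by have [B BP] := adjoint_exists A; case: (h B).
Qed.

Lemma rdot_adjoint (A : bop H) x y : rdot (A x) y = rdot x (adjoint dot A y).
Proof. by rewrite /rdot adjointP. Qed.

End RealInnerProduct.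

(** * Completeness of the bounded operators *)

Section BoundedOperatorNorm.
Variables (R : realType) (H : normedModType R[i]).
Implicit Types A B : bop H.

Lemma rnorm_bop A x : rnorm (A x) <= rnorm A * rnorm x.
Proof. exact: opnormP. Qed.

Lemma bop_sumE I (r : seq I) (P : pred I) (f : I -> bop H) v :
  (\sum_(i <- r | P i) f i) v = \sum_(i <- r | P i) f i v.
Proof. exact: (big_morph (fun A : bop H => A v)). Qed.

Lemma bop_mulE A B v : (A * B) v = A (B v).
Proof. by []. Qed.

Lemma bop_subE A B v : (A - B) v = A v - B v.
Proof. by []. Qed.

End BoundedOperatorNorm.

Lemma bop_cauchy_cvg (R : realType) (H : completeNormedModType R[i]) T
    (F : set_system T) {FF : ProperFilter F} (f : T -> bop H) :
  (forall eps : R, 0 < eps -> exists2 S, F S &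
     forall s t, S s -> S t -> rnorm (f s - f t) <= eps) ->
  exists L : bop H, f @ F --> L.
Proof.
move=> fC.
have fvC v : exists l : H, (fun t => f t v) @ F --> l.
  apply: cauchy_rnorm_cvg => eps eps0.
  have v0 : 0 < rnorm v + 1 by rewrite ltr_wpDl ?rnorm_ge0.
  have [|S FS SC] := fC (eps / (rnorm v + 1)); first by rewrite divr_gt0.
  exists S => // s t Ss St; rewrite -bop_subE (le_trans (rnorm_bop _ _)) //.
  rewrite (le_trans (ler_wpM2r (rnorm_ge0 _) (SC _ _ Ss St))) //.
  rewrite -mulrA ler_piMr ?(ltW eps0) // ler_pdivrMl //; lra.
have [l lP] := choice fvC.
have llin : linear l.
  move=> a u v; apply: (@cvg_unique _ (@norm_hausdorff _ _) (fmap (fun t => f t (a *: u + v)) F)).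
    exact: lP.
  have -> : (fun t => f t (a *: u + v)) = (fun t => a *: f t u + f t v).
    by apply/funext => t; rewrite bop_linear.
  by apply: cvgD; [apply: cvgZr; exact: lP|exact: lP].
have lle S s v c : F S -> (forall t, S t -> rnorm (f t v - f s v) <= c) ->
    rnorm (l v - f s v) <= c.
  move=> FS Sc; apply/ler_addgt0Pr => eps eps0.
  have /cvg_rnormP/(_ _ eps0) h := lP v.
  have [t [St tl]] := filter_ex (filterI FS h).
  have := rnormD (f t v - f s v) (l v - f t v).
  rewrite [rnorm (l v - _)]rnormB addrC addrA subrK => /le_trans; apply.
  by rewrite lerD ?Sc.
have bound eps : 0 < eps -> exists2 S, F S & forall s v, S s ->
    rnorm (l v - f s v) <= eps * rnorm v.
  move=> eps0; have [S FS SC] := fC _ eps0.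
  exists S => // s v Ss; apply: (lle S) => // t St.
  rewrite -bop_subE (le_trans (rnorm_bop _ _)) //.
  by rewrite ler_wpM2r ?rnorm_ge0 ?SC.
have lbd : exists M : R, forall v, rnorm (l v) <= M * rnorm v.
  have [S FS Sb] := bound 1 ltr01; have [s Ss] := filter_ex FS.
  exists (1 + rnorm (f s)) => v.
  rewrite -[l v](subrK (f s v)) (le_trans (rnormD _ _)) // mulrDl lerD ?Sb //.
  exact: rnorm_bop.
exists (Bop llin lbd); apply/cvg_rnormP => eps eps0.
have [S FS Sb] := bound _ eps0; apply: filterS FS => s Ss.
rewrite rnormB; apply: opnorm_le => v v1.
rewrite (le_trans (Sb s v Ss)) // ler_piMr //; exact: ltW.
Qed.

(** * The module [l_2(C)] through quadratic forms *)

#[local] Existing Instance summability.totally_filter.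

Section L2Module.
Variables (R : realType) (H : completeNormedModType R[i]).
Variable dot : {dot H for Num.conj}.
Hypothesis H_hilbert : hilbert_norm dot.
Implicit Types (x y : int -> bop H) (F G : {fset int}) (u v : H).

Local Notation psum x F := (summability.partial_sum (gram_seq dot x) F).

(* The quadratic form at [v] of the partial sum of [x_j^* x_j] over [F]; norms of
   such partial sums are suprema of it over the unit ball. *)
Definition sqsum F x v : R := \sum_(j <- F) rnorm (x j v) ^+ 2.

Lemma partial_sumE (V : zmodType) (f : int -> V) F :
  summability.partial_sum f F = \sum_(j <- F) f j.
Proof. by rewrite big_seq_fsetE. Qed.

Lemma big_fset_diff (V : zmodType) (f : int -> V) F G : (F `<=` G)%fset ->
  \sum_(j <- G) f j = \sum_(j <- F) f j + \sum_(j <- (G `\` F)%fset) f j.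
Proof.
move=> /fsubsetP FG; rewrite (big_fsetID _ (mem F) G) /=; congr (_ + _).
  apply: eq_fbigl => j; rewrite !inE /=.
  by case: (boolP (j \in F)) => [/FG ->|]; rewrite ?andbF.
by apply: eq_fbigl => j; rewrite !inE /= andbC.
Qed.

Lemma sqsum_ge0 F x v : 0 <= sqsum F x v.
Proof. by apply: sumr_ge0 => j _; rewrite sqr_ge0. Qed.

Lemma sqsum_subset F G x v : (F `<=` G)%fset -> sqsum F x v <= sqsum G x v.
Proof.
by move=> FG; rewrite /sqsum (big_fset_diff _ FG) lerDl sqsum_ge0.
Qed.

Lemma sqsumB_le F x y v :
  sqsum F (fun j => x j - y j) v <= 2 * sqsum F x v + 2 * sqsum F y v.
Proof.
rewrite /sqsum !mulr_sumr -big_split /=; apply: ler_sum => j _.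
by have := rnorm_sqrD_le H_hilbert (x j v) (- y j v); rewrite rnormN.
Qed.

Lemma rdot_sumE I (r : seq I) (f : I -> H) v :
  rdot dot (\sum_(i <- r) f i) v = \sum_(i <- r) rdot dot (f i) v.
Proof.
apply: (big_morph (fun u => rdot dot u v)) => [a b|]; first exact: rdotDl.
by rewrite /rdot linear0l.
Qed.

Lemma rdot_gram F x u v :
  rdot dot (psum x F u) v = \sum_(j <- F) rdot dot (x j u) (x j v).
Proof.
rewrite partial_sumE bop_sumE rdot_sumE; apply: eq_bigr => j _ /=.
by rewrite rdotC -rdot_adjoint // rdotC.
Qed.

Lemma rdot_gram_sqsum F x v : rdot dot (psum x F v) v = sqsum F x v.
Proof. by rewrite rdot_gram; apply: eq_bigr => j _; rewrite (rnorm_sqr H_hilbert). Qed.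

Lemma rnorm_gram_le F x (c : R) :
  (forall v, rnorm v <= 1 -> sqsum F x v <= c) -> rnorm (psum x F) <= c.
Proof.
move=> Fc; apply: opnorm_le => v v1; set w := psum x F v.
have [w0|w0] := eqVneq (rnorm w) 0.
  by rewrite w0 (le_trans (sqsum_ge0 F x v)) ?Fc.
have wgt0 : 0 < rnorm w by rewrite lt0r w0 rnorm_ge0.
pose u := (rnorm w)^-1%:C *: w.
have u1 : rnorm u <= 1 by rewrite rnormZr ger0_norm ?invr_ge0 ?rnorm_ge0 // mulVf.
have -> : rnorm w = rdot dot w u.
  by rewrite rdotZr -(rnorm_sqr H_hilbert) expr2 mulrA mulVf // mul1r.
rewrite rdot_gram.
have : 2 * \sum_(j <- F) rdot dot (x j v) (x j u) <= sqsum F x v + sqsum F x u.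
  rewrite mulr_sumr /sqsum -big_split /=; apply: ler_sum => j _.
  exact: rdot_le.
have := Fc _ v1; have := Fc _ u1; lra.
Qed.

Lemma sqsum_le_rnorm_gram F x v : rnorm v <= 1 -> sqsum F x v <= rnorm (psum x F).
Proof.
move=> v1; rewrite -rdot_gram_sqsum (le_trans (rdot_cauchy_schwarz H_hilbert _ _)) //.
have := rnorm_bop (psum x F) v; have := rnorm_ge0 v; have := rnorm_ge0 (psum x F).
have := rnorm_ge0 (psum x F v); nra.
Qed.

Definition l2_tail x := forall eps : R, 0 < eps -> exists F, forall G v,
  [disjoint F & G]%fset -> rnorm v <= 1 -> sqsum G x v <= eps.

Lemma cvg_gram_dist x : cvg (summability.partial_sum (gram_seq dot x)
    @ summability.totally) ->
  forall eps : R, 0 < eps -> exists F, forall G, (F `<=` G)%fset ->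
    rnorm (psum x G - summability.sum (gram_seq dot x)) <= eps.
Proof.
move=> xc eps eps0.
have /cvg_rnormP/(_ _ eps0)[F _ FP] := xc.
by exists F => G FG; exact: FP.
Qed.

Lemma cvg_gramP x :
  cvg (summability.partial_sum (gram_seq dot x) @ summability.totally) <->
  l2_tail x.
Proof.
split=> [xc eps eps0|xt].
  have e2 : 0 < eps / 2 by rewrite divr_gt0.
  have [F FP] := cvg_gram_dist xc e2; exists F => G v FG v1.
  rewrite (le_trans (sqsum_le_rnorm_gram _ _ v1)) //.
  have -> : psum x G = psum x (F `|` G)%fset - psum x F.
    rewrite !partial_sumE (big_fset_diff _ (fsubsetUl F G)) addrC addKr.
    apply: eq_fbigl => j; rewrite !inE.
    case: (boolP (j \in G)) => jG; last by rewrite orbF andNb.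
    by rewrite orbT andbT; move/fdisjointP_sym: FG => ->.
  have := rnormBD (psum x (F `|` G)%fset - summability.sum (gram_seq dot x))
    (psum x F - summability.sum (gram_seq dot x)).
  rewrite opprB addrA subrK => /le_trans; apply.
  have := FP _ (fsubsetUl F G); have := FP _ (fsubset_refl F).
  lra.
apply/cvg_ex; apply: bop_cauchy_cvg => eps eps0.
have [|F FP] := xt (eps / 2); first by rewrite divr_gt0.
exists [set G | (F `<=` G)%fset]; first by exists F.
have psF G : (F `<=` G)%fset -> rnorm (psum x G - psum x F) <= eps / 2.
  move=> FG; rewrite !partial_sumE (big_fset_diff _ FG) addrC addKr -partial_sumE.
  apply: rnorm_gram_le => v v1; apply: FP => //.
  by apply/fdisjointP => j jF; rewrite inE jF.
move=> G G' /psF FG /psF FG'.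
have := rnormBD (psum x G - psum x F) (psum x G' - psum x F).
rewrite opprB addrA subrK => /le_trans; apply; lra.
Qed.

Lemma l2_tailB x y : l2_tail x -> l2_tail y -> l2_tail (fun j => x j - y j).
Proof.
move=> xt yt eps eps0.
have e4 : 0 < eps / 4 by rewrite divr_gt0.
have [F FP] := xt _ e4; have [F' FP'] := yt _ e4.
exists (F `|` F')%fset => G v; rewrite fdisjointUX => /andP[FG F'G] v1.
rewrite (le_trans (sqsumB_le _ _ _ _)) //.
have := FP _ _ FG v1; have := FP' _ _ F'G v1; lra.
Qed.

Lemma l2norm_le x (c : R) : l2_tail x -> 0 <= c ->
  (forall F v, rnorm v <= 1 -> sqsum F x v <= c ^+ 2) -> l2norm dot x <= c.
Proof.
move=> /cvg_gramP xc c0 Fc.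
rewrite /l2norm -[leRHS](ger0_norm c0) -sqrtr_sqr ler_wsqrtr //.
apply/ler_addgt0Pr => eps eps0.
have [F FP] := cvg_gram_dist xc eps0.
have := FP _ (fsubset_refl F); rewrite rnormB => FL.
have := rnormD (summability.sum (gram_seq dot x) - psum x F) (psum x F).
rewrite subrK => /le_trans; apply.
by rewrite addrC lerD // rnorm_gram_le // => v; exact: Fc.
Qed.

Lemma sqsum_le_l2norm F x v : l2_tail x -> rnorm v <= 1 ->
  sqsum F x v <= l2norm dot x ^+ 2.
Proof.
move=> /cvg_gramP xc v1; rewrite /l2norm sqr_sqrtr ?rnorm_ge0 //.
apply/ler_addgt0Pr => eps eps0.
have [G GP] := cvg_gram_dist xc eps0.
rewrite (le_trans (sqsum_subset _ _ (fsubsetUr G F))) //.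
rewrite (le_trans (sqsum_le_rnorm_gram _ _ v1)) //.
rewrite -[X in rnorm X](subrK (summability.sum (gram_seq dot x))).
rewrite (le_trans (rnormD _ _)) // addrC lerD //.
exact/GP/fsubsetUl.
Qed.

Lemma l2_tail_entry x : l2_tail x -> forall eps : R, 0 < eps ->
  exists F : {fset int}, forall j, j \notin F -> rnorm (x j) <= eps.
Proof.
move=> xt eps eps0.
have [|F FP] := xt (eps ^+ 2); first by rewrite exprn_gt0.
exists F => j jF; apply: opnorm_le => v v1.
rewrite -(@ler_pXn2r _ 2) ?nnegrE ?rnorm_ge0 ?(ltW eps0) //.
have := FP [fset j]%fset v; rewrite /sqsum big_seq_fset1; apply=> //.
by rewrite fdisjointX1.
Qed.

End L2Module.

(** * Compact operators and orthonormal bases *)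

Section CompactOperators.
Variables (R : realType) (H : completeNormedModType R[i]).
Implicit Types A B K : bop H.

Lemma bop_continuous A : continuous A.
Proof.
move=> x; apply/cvg_rnormP => eps eps0.
have A0 : 0 < rnorm A + 1 by rewrite ltr_wpDl ?rnorm_ge0.
have d0 : 0 < eps / (rnorm A + 1) by rewrite divr_gt0.
have /cvg_rnormP/(_ _ d0) := @cvg_id _ (nbhs x).
apply: filterS => y yx; rewrite -bopB (le_trans (rnorm_bop _ _)) //.
rewrite (le_trans (ler_wpM2l (rnorm_ge0 _) yx)) //.
rewrite mulrCA ler_piMr ?(ltW eps0) // ler_pdivrMr //; lra.
Qed.

Lemma compact_operatorMl A K : compact_operator K -> compact_operator (A * K).
Proof.
rewrite /compact_operator precompactE => Kc.
apply: (@precompact_subset _ _ (A @` closure [set K x | x in [set x | rnorm x <= 1]])).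
  by move=> _ [x x1 <-]; exists (K x) => //; apply: subset_closure; exists x.
apply: compact_precompact; first exact: norm_hausdorff.
by apply: continuous_compact => //; apply: continuous_subspaceT; exact: bop_continuous.
Qed.

Lemma compact_operatorMr K B : compact_operator K -> compact_operator (K * B).
Proof.
move=> Kc; have B0 : 0 < rnorm B + 1 by rewrite ltr_wpDl ?rnorm_ge0.
have := compact_operatorMl ((rnorm B + 1)%:C *: (1 : bop H)) Kc.
apply: precompact_subset => _ [x /= x1 <-].
exists ((rnorm B + 1)^-1%:C *: B x) => /=; last first.
  rewrite bopZ scalerA -rmorphM /= mulfV ?gt_eqF // scale1r //.
rewrite rnormZr ger0_norm ?invr_ge0 ?(ltW B0) // ler_pdivrMl // mulr1.
have := rnorm_bop B x; have := rnorm_ge0 B; nra.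
Qed.

Lemma compact_operator0 : compact_operator (0 : bop H).
Proof.
apply: (@precompact_subset _ _ [set 0]); first by move=> _ [x _ <-].
by apply: compact_precompact; [exact: norm_hausdorff|exact: compact_set1].
Qed.

Lemma compact_operator_net K (eps : R) : compact_operator K -> 0 < eps ->
  exists s : seq H, forall x, rnorm x <= 1 ->
    exists2 y, y \in s & rnorm (K x - y) <= eps.
Proof.
rewrite /compact_operator precompactE compact_cover => Kc eps0.
have [|x _|D _ KD] := Kc H setT (fun y => ball y eps%:C).
- by move=> y _; exact: ball_open.
- by exists x => //; apply: ballxx; rewrite ltcR.
exists (enum_fset D) => x x1.
have [|y yD] := KD (K x); first by apply: subset_closure; exists x.
rewrite -ball_normE /= rnormE ltcR rnormB => /ltW yx.
by exists y.
Qed.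

End CompactOperators.

Section OrthonormalBasis.
Variables (R : realType) (H : completeNormedModType R[i]).
Variable dot : {dot H for Num.conj}.
Hypothesis H_hilbert : hilbert_norm dot.
Variable e : int -> H.
Hypothesis e_basis : orthonormal_basis dot e.
Implicit Types (s : seq int) (u v w y : H) (i j : int) (J : set int).

Local Notation rdot := (rdot dot).

Definition sqcoef v i : R :=
  complex.Re (dot v (e i)) ^+ 2 + complex.Im (dot v (e i)) ^+ 2.

Definition fourier_sum s v : H := \sum_(i <- s) dot v (e i) *: e i.

Lemma dotBl u v w : dot (u - v) w = dot u w - dot v w.
Proof. exact: linearBl. Qed.

Lemma dotBr u v w : dot w (u - v) = dot w u - dot w v.
Proof. exact: linearBr. Qed.

Lemma dot_suml I (r : seq I) (f : I -> H) v :
  dot (\sum_(k <- r) f k) v = \sum_(k <- r) dot (f k) v.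
Proof.
apply: (big_morph (fun u => dot u v)) => [a b|]; first exact: linearDl.
by rewrite linear0l.
Qed.

Lemma dot_sumr I (r : seq I) (f : I -> H) v :
  dot v (\sum_(k <- r) f k) = \sum_(k <- r) dot v (f k).
Proof.
apply: (big_morph (fun u => dot v u)) => [a b|]; first exact: linearDr.
by rewrite linear0r.
Qed.

Lemma dot_fourier_sum s v i : uniq s -> i \in s ->
  dot (fourier_sum s v) (e i) = dot v (e i).
Proof.
move=> us si; rewrite dot_suml (bigD1_seq i) //= linearZl_LR /= e_basis.1 eqxx mulr1.
rewrite big1 ?addr0 // => j ji.
by rewrite linearZl_LR /= e_basis.1 (negbTE ji) mulr0.
Qed.

Lemma rdot_fourier_sum s v : rdot v (fourier_sum s v) = \sum_(i <- s) sqcoef v i.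
Proof.
rewrite /rdot dot_sumr (raddf_sum (@complex.Re R : Rcomplex R -> R)).
apply: eq_bigr => i _; rewrite linearZr_LR /= /sqcoef.
case: (dot v (e i)) => a b /=; ring.
Qed.

Lemma bessel s v : uniq s -> \sum_(i <- s) sqcoef v i <= rnorm v ^+ 2.
Proof.
move=> us; set q := fourier_sum s v.
have qq : rdot v q = rdot q q.
  rewrite /rdot; congr complex.Re.
  have E y : dot y q = \sum_(i <- s) dot y (dot v (e i) *: e i) by rewrite dot_sumr.
  rewrite !E.
  apply: eq_big_seq => i si; rewrite !linearZr_LR /=.
  by rewrite dot_fourier_sum.
have := sqr_ge0 (rnorm (v - q)).
rewrite (rnorm_sqrB H_hilbert) // -rdot_fourier_sum -/q qq -(rnorm_sqr H_hilbert) //; lra.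
Qed.

Lemma span_of_basis J i : J i -> span_of e J (e i).
Proof.
move=> Ji; exists 1%N, (fun=> 1), (fun=> i); split=> //.
by rewrite big_ord1 scale1r.
Qed.

Lemma dot_span_eq0 J u y : (forall i, J i -> dot u (e i) = 0) ->
  span_of e J y -> dot u y = 0.
Proof.
move=> uJ [n [c [k [kJ ->]]]]; rewrite dot_sumr big1 // => l _.
by rewrite linearZr_LR /= uJ ?mulr0.
Qed.

Section Projection.
Variables (J : set int) (s : seq int) (Q : bop H).
Hypotheses (s_uniq : uniq s) (Js : forall i, J i <-> i \in s).
Hypothesis Q_proj : orthogonal_projection dot Q (span_of e J).

Lemma proj_coef v i : J i -> dot (Q v) (e i) = dot v (e i).
Proof.
move=> Ji; have := (Q_proj v).2 _ (span_of_basis Ji).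
by rewrite dotBl => /eqP; rewrite subr_eq0 => /eqP ->.
Qed.

Lemma proj_fourier_sum v : Q v = fourier_sum s v.
Proof.
apply/eqP; rewrite -subr_eq0; apply/eqP; set u := _ - _.
have uJ i : J i -> dot u (e i) = 0.
  move=> Ji; rewrite /u dotBl proj_coef // dot_fourier_sum ?subrr //.
  exact/Js.
apply: rnorm_eq0; apply/eqP; rewrite -sqrf_eq0 (rnorm_sqr H_hilbert) // /rdot {2}/u dotBr.
rewrite (dot_span_eq0 uJ (Q_proj v).1) dot_sumr big_seq big1 ?subrr //.
by move=> i /Js Ji; rewrite linearZr_LR /= uJ ?mulr0.
Qed.

Lemma proj_idem v : Q (Q v) = Q v.
Proof.
rewrite proj_fourier_sum [in RHS]proj_fourier_sum.
by apply: eq_big_seq => i /Js Ji; rewrite proj_coef.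
Qed.

Lemma rdot_proj v w : rdot (v - Q v) (Q w) = 0.
Proof. by rewrite /rdot (Q_proj v).2 //; exact: (Q_proj w).1. Qed.

Lemma rdot_projC v w : rdot (v - Q v) w = rdot v (w - Q w).
Proof.
have h := rdot_proj v w.
have h' := rdot_proj w v; rewrite rdotC in h'.
have -> : rdot (v - Q v) w = rdot (v - Q v) (w - Q w) by rewrite rdotBr h subr0.
by rewrite rdotBl h' subr0.
Qed.

Lemma rnorm_proj v : rnorm (Q v) ^+ 2 = \sum_(i <- s) sqcoef v i.
Proof.
have := rdot_proj v v; rewrite rdotBl => /eqP; rewrite subr_eq0 => /eqP h.
by rewrite (rnorm_sqr H_hilbert) // -h proj_fourier_sum rdot_fourier_sum.
Qed.

Lemma rnorm_proj_le v : rnorm (Q v) <= rnorm v.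
Proof.
rewrite -(@ler_pXn2r _ 2) ?nnegrE ?rnorm_ge0 // rnorm_proj; exact: bessel.
Qed.

Lemma rnorm_subproj v y : span_of e J y -> rnorm (v - Q v) <= rnorm (v - y).
Proof.
move=> yJ; rewrite -(@ler_pXn2r _ 2) ?nnegrE ?rnorm_ge0 //.
have -> : v - y = (v - Q v) + (Q v - y) by rewrite addrA subrK.
rewrite [leRHS](rnorm_sqrD H_hilbert) // rdotBr rdot_proj /rdot (Q_proj v).2 //.
have := sqr_ge0 (rnorm (Q v - y)); lra.
Qed.

Lemma rnorm_subproj_le v : rnorm (v - Q v) <= rnorm v.
Proof.
rewrite -(@ler_pXn2r _ 2) ?nnegrE ?rnorm_ge0 //.
have -> : rnorm v ^+ 2 = rnorm (v - Q v + Q v) ^+ 2 by rewrite subrK.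
rewrite [leRHS](rnorm_sqrD H_hilbert) // rdot_proj.
have := sqr_ge0 (rnorm (Q v)); lra.
Qed.

End Projection.

Definition sym_range (m : nat) : seq int := [seq k%:Z - m%:Z | k <- iota 0 (2 * m).+1].

Lemma sym_range_uniq m : uniq (sym_range m).
Proof. by rewrite map_inj_uniq ?iota_uniq // => a b; lia. Qed.

Lemma mem_sym_range m i : (i \in sym_range m) = (- m%:Z <= i <= m%:Z).
Proof.
apply/mapP/idP => [[k]|].
  by rewrite mem_iota => kP ->; lia.
by move=> iP; exists (absz (i + m%:Z)); rewrite ?mem_iota; lia.
Qed.

Lemma sym_range_setP m i :
  [set j : int | (- m%:Z <= j <= m%:Z)%R] i <-> i \in sym_range m.
Proof. by rewrite mem_sym_range. Qed.

Variable P : nat -> bop H.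
Hypothesis P_proj : forall m : nat, (0 < m)%N ->
  orthogonal_projection dot (P m) (span_of e [set j : int | (- m%:Z <= j <= m%:Z)%R]).

Lemma proj_cvg v (eps : R) : 0 < eps ->
  exists M, forall m, (M < m)%N -> rnorm (v - P m v) <= eps.
Proof.
move=> eps0; have : closure (span_of e setT) v by rewrite e_basis.2.
have eC : 0 < eps%:C by rewrite ltcR.
move=> /(_ _ (nbhsx_ballx v _ eC))[_ [[n [c [k [_ ->]]]]]].
set y := \sum_(_ < _) _ => vy.
exists (\max_(l < n) `|k l|)%N => m Mm.
have m0 : (0 < m)%N by exact: leq_ltn_trans Mm.
rewrite (le_trans (rnorm_subproj (P_proj m0) (y := y) _ _)) //.
  exists n, c, k; split=> // l /=.
  have := @leq_bigmax 'I_n (fun l => absz (k l)) l.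
  by move=> /= h; have := leq_ltn_trans h Mm; lia.
by move: vy; rewrite -ball_normE /= rnormE ltcR => /ltW.
Qed.

Lemma compact_proj_cvg K (eps : R) : compact_operator K -> 0 < eps ->
  exists M, forall m, (M < m)%N -> rnorm (K - K * P m) <= eps.
Proof.
move=> Kc eps0; have e2 : 0 < eps / 2 by rewrite divr_gt0.
have e4 : 0 < eps ^+ 2 / 4 by rewrite divr_gt0 ?exprn_gt0.
have [ys ysP] := compact_operator_net Kc e2.
have [M MP] : exists M, forall m, (M < m)%N -> forall y, y \in ys ->
    rnorm (adjoint dot K y - P m (adjoint dot K y)) <= eps ^+ 2 / 4.
  elim: ys {ysP} => [|y ys [M MP]]; first by exists 0%N.
  have [M' MP'] := proj_cvg (adjoint dot K y) e4.
  exists (maxn M M') => m; rewrite gtn_max => /andP[Mm M'm] z.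
  by rewrite inE => /predU1P[->|/MP]; [exact: MP'|exact].
exists M => m Mm; have m0 : (0 < m)%N by exact: leq_ltn_trans Mm.
apply: opnorm_le => v v1.
have -> : (K - K * P m) v = K (v - P m v) by rewrite bopB.
set u := K _.
have [|y yys uy] := ysP (v - P m v).
  exact: le_trans (rnorm_subproj_le (P_proj m0) v) v1.
have h1 := rdot_cauchy_schwarz H_hilbert u (u - y).
have h2 : rdot u y <= eps ^+ 2 / 4.
  rewrite /u rdot_adjoint // (rdot_projC (P_proj m0)).
  rewrite (le_trans (rdot_cauchy_schwarz H_hilbert _ _)) //.
  have := MP _ Mm _ yys; have := rnorm_ge0 v.
  by have := rnorm_ge0 (adjoint dot K y - P m (adjoint dot K y)); nra.
have h3 : rnorm u ^+ 2 = rdot u (u - y) + rdot u y.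
  by rewrite (rnorm_sqr H_hilbert) // rdotBr subrK.
have h4 := ler_wpM2l (rnorm_ge0 u) uy.
rewrite leNgt; apply/negP => ue.
have : rnorm u * (rnorm u - eps / 2) > eps * (eps / 2).
  by apply: ltr_pM => //; lra.
rewrite mulrBr -!expr2; lra.
Qed.

End OrthonormalBasis.

(** * The gauge of the weights *)

(* Conjugating by [G] turns the weighted shift of [W] into the plain one. *)
Lemma gauge_exists (A : pzRingType) (W V : int -> A) :
  (forall j, W j * V j = 1 /\ V j * W j = 1) ->
  exists G G' : int -> A, [/\ forall j, G j * G' j = 1, forall j, G' j * G j = 1
    & forall j, G j = W j * G (j - 1)].
Proof.
move=> WV.
pose G j := match j with
  | Posz n => iteri n (fun k x => W k.+1%:Z * x) 1
  | Negz n => iteri n.+1 (fun k x => V (- k%:Z) * x) 1 end.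
pose G' j := match j with
  | Posz n => iteri n (fun k x => x * V k.+1%:Z) 1
  | Negz n => iteri n.+1 (fun k x => x * W (- k%:Z)) 1 end.
have cancel4 (a b c d : A) : b * c = 1 -> a * d = 1 -> a * b * (c * d) = 1.
  by move=> bc ad; rewrite mulrA -(mulrA a) bc mulr1.
exists G, G'; split.
- case=> n; rewrite /G /G'; [elim: n => [|n IH]|elim: n.+1 => [|{}n IH]];
    rewrite /= ?mulr1 //; apply: cancel4 => //.
  - by have [] := WV n.+1.
  - by have [] := WV (- n%:Z).
- case=> n; rewrite /G /G'; [elim: n => [|n IH]|elim: n.+1 => [|{}n IH]];
    rewrite /= ?mulr1 //; apply: cancel4 => //.
  - by have [] := WV n.+1.
  - by have [] := WV (- n%:Z).
case=> [[|n]|n].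
- by rewrite sub0r /G /= mulr1 (WV 0).1.
- by have -> : n.+1%:Z - 1 = n by lia.
have -> : Negz n - 1 = Negz n.+1 by lia.
rewrite /G [RHS]/= mulrA (_ : - n.+1%:Z = Negz n); last by lia.
by rewrite (WV (Negz n)).1 mul1r.
Qed.

Section TailSup.
Variables (R : realType) (H : completeNormedModType R[i]).

Lemma tail_sup_cvg0P (A : nat -> bop H) : tail_sup_cvg0 A <->
  forall eps : R, 0 < eps -> exists N, forall n, (N <= n)%N -> rnorm (A n) <= eps.
Proof.
pose S m := ereal_sup [set (rnorm (A n))%:E
                      | n in [set n | (0 < n)%N /\ (m <= n)%N]].
have S_ub m n : (0 < n)%N -> (m <= n)%N -> ((rnorm (A n))%:E <= S m)%E.
  by move=> n0 mn; apply: ereal_sup_ubound; exists n.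
split=> [/fine_cvgP[/= [N0 _ Sfin] /cvgrPdist_le Slim] eps /Slim [N1 _ SN]|Alim].
  exists (maxn 1 (maxn N0 N1)) => n; rewrite !geq_max => /and3P[n0 nN0 nN1].
  have := SN n nN1; rewrite /= sub0r normrN => /(le_trans (ler_norm _)) Sn.
  rewrite -lee_fin (le_trans (S_ub n n n0 (leqnn n))) // -[S n]fineK ?lee_fin //.
  exact: Sfin.
have S_ge0 m : (0 <= S m)%E.
  apply: le_trans (S_ub m (maxn 1 m) _ _); rewrite ?leq_maxl ?leq_maxr //.
  by rewrite lee_fin rnorm_ge0.
have S_le N (eps : R) m : (forall n, (N <= n)%N -> rnorm (A n) <= eps) ->
    (N <= m)%N -> (S m <= eps%:E)%E.
  move=> AN Nm; apply: ge_ereal_sup => _ [n [_ mn] <-].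
  by rewrite lee_fin AN // (leq_trans Nm).
have Sfin N (eps : R) m : (forall n, (N <= n)%N -> rnorm (A n) <= eps) ->
    (N <= m)%N -> S m \is a fin_num.
  move=> AN Nm; rewrite ge0_fin_numE //.
  exact: le_lt_trans (S_le _ _ _ AN Nm) (ltry _).
apply/fine_cvgP; split.
  have [N AN] := Alim 1 ltr01; exists N => // m /= Nm.
  exact: Sfin AN Nm.
apply/cvgrPdist_le => eps eps0.
have [N AN] := Alim eps eps0; exists N => // m /= Nm.
rewrite sub0r normrN ger0_norm; last exact/fine_ge0/S_ge0.
by rewrite -lee_fin fineK ?(Sfin _ _ _ AN) // (S_le _ _ _ AN).
Qed.

End TailSup.

Section Gauge.
Variables (R : realType) (H : completeNormedModType R[i]).
Variables (W V G G' : int -> bop H).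
Hypotheses (WV : forall j, W j * V j = 1 /\ V j * W j = 1)
  (GG' : forall j, G j * G' j = 1) (GW : forall j, G j = W j * G (j - 1)).

Lemma prod_above_gauge r k : prod_above W r k = G (r + k%:Z) * G' r.
Proof.
elim: k => [|k IH]; first by rewrite /prod_above big_ord0 addr0 GG'.
rewrite /prod_above big_ord_recl subr0 GW.
have -> : r + k.+1%:Z - 1 = r + k%:Z by lia.
rewrite -[RHS]mulrA -IH; congr (_ * _); apply: eq_bigr => i _; congr W.
by rewrite /= /bump /=; lia.
Qed.

Lemma prod_below_gauge r k : prod_below V r k = G (r - k%:Z) * G' r.
Proof.
elim: k => [|k IH]; first by rewrite /prod_below big_ord0 subr0 GG'.
have -> : G (r - k.+1%:Z) = V (r - k%:Z) * G (r - k%:Z).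
  rewrite [in RHS]GW mulrA (WV _).2 mul1r; congr G; lia.
rewrite -mulrA -IH /prod_below big_ord_recl addr0; congr (V _ * _); first by lia.
by apply: eq_bigr => i _; congr V; rewrite /= /bump /=; lia.
Qed.

End Gauge.

(** * Powers of the shift and orthogonal blocks *)

Section BilateralShift.
Variables (R : realType) (H : completeNormedModType R[i]).
Variable dot : {dot H for Num.conj}.
Hypothesis H_hilbert : hilbert_norm dot.
Variables (e : int -> H) (U : bop H).
Hypotheses (U_unitary : unitary_op dot U)
  (U_shift : forall j : int, U (e j) = e (j + 1)).
Implicit Types (v : H) (i j k : int).

Definition shift_pow k : bop H :=
  match k with Posz n => U ^+ n | Negz n => adjoint dot U ^+ n.+1 end.

Lemma shift_powS k : shift_pow k * U = shift_pow (k + 1).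
Proof.
case: k => [n|n].
  have -> : n%:Z + 1 = n.+1%:Z by lia.
  by rewrite /= exprSr.
rewrite /= exprSr -mulrA U_unitary.1 mulr1.
case: n => [//|n].
by have -> : Negz n.+1 + 1 = Negz n by lia.
Qed.

Lemma shift_powD k n : shift_pow k * U ^+ n = shift_pow (k + n%:Z).
Proof.
elim: n => [|n IH]; first by rewrite mulr1 addr0.
rewrite exprSr mulrA IH shift_powS; congr shift_pow; lia.
Qed.

Lemma dot_shift_pow k v i : dot (shift_pow k v) (e i) = dot v (e (i - k)).
Proof.
have dU w j : dot (U w) (e j) = dot w (e (j - 1)).
  rewrite adjointP // (_ : e j = U (e (j - 1))); last by rewrite U_shift subrK.
  by rewrite -bop_mulE U_unitary.1.
have dUV w j : dot (adjoint dot U w) (e j) = dot w (e (j + 1)).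
  rewrite -[j in LHS](addrK 1) -dU.
  by rewrite -bop_mulE U_unitary.2.
case: k => n /=.
  elim: n i => [|n IH] i; first by rewrite subr0.
  rewrite exprS bop_mulE dU IH.
  by have -> : i - 1 - n%:Z = i - n.+1%:Z by lia.
have -> : i - Negz n = i + n.+1%:Z by lia.
elim: n.+1 i => [|{}n IH] i; first by rewrite addr0.
rewrite exprS bop_mulE dUV IH.
by have -> : i + 1 + n%:Z = i + n.+1%:Z by lia.
Qed.

Lemma rnorm_unitary v : rnorm (U v) = rnorm v.
Proof.
apply/eqP; rewrite -(@eqrXn2 _ 2) ?rnorm_ge0 // !(rnorm_sqr H_hilbert).
rewrite rdot_adjoint // -bop_mulE.
by rewrite U_unitary.1.
Qed.

Lemma rnorm_unitary_pow n v : rnorm ((U ^+ n) v) = rnorm v.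
Proof.
elim: n => [//|n IH].
by rewrite exprS bop_mulE rnorm_unitary.
Qed.

Lemma rnorm_adjoint_pow_le n v : rnorm ((adjoint dot U ^+ n) v) <= rnorm v.
Proof.
elim: n v => [//|n IH] v.
rewrite exprSr bop_mulE.
rewrite (le_trans (IH _)) // -[leLHS]rnorm_unitary.
by rewrite -bop_mulE U_unitary.2.
Qed.

Lemma unitary_powK n : U ^+ n * adjoint dot U ^+ n = 1.
Proof.
elim: n => [|n IH]; first by rewrite mulr1.
by rewrite exprSr exprS mulrA -(mulrA _ U) U_unitary.2 mulr1.
Qed.

Lemma iter_weighted_shift (W G G' : int -> bop H) (a : int -> bop H) n j :
  (forall j, G j * G' j = 1) -> (forall j, G' j * G j = 1) ->
  (forall j, G j = W j * G (j - 1)) ->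
  iter n (weighted_shift dot U W) a j = G j * G' (j - n%:Z) * a (j - n%:Z) * U ^+ n.
Proof.
move=> GG' G'G GW; elim: n j => [|n IH] j.
  by rewrite subr0 GG' mul1r mulr1.
rewrite iterS weighted_shiftE // IH.
have -> : j - n.+1%:Z = j - 1 - n%:Z by lia.
by rewrite exprSr !mulrA -GW.
Qed.

Section Blocks.
Hypothesis e_basis : orthonormal_basis dot e.
Variables (m D K : nat) (Q : bop H).
Hypotheses (mD : (2 * m < D)%N) (Q_proj : orthogonal_projection dot Q
   (span_of e [set j : int | (- m%:Z <= j <= m%:Z)%R])).
Variables (a : int -> nat) (q : int -> int).
Hypothesis aq_inj : forall j j', a j = a j' -> q j = q j' -> j = j'.

Definition block_seq (B : int -> bop H) j : bop H :=
  if (a j < K)%N then B j * Q * shift_pow (q j * D%:Z) else 0.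

Lemma rnorm_proj_shift k v : rnorm (Q (shift_pow k v)) ^+ 2 =
  \sum_(i <- sym_range m) sqcoef dot e v (i - k).
Proof.
rewrite (rnorm_proj H_hilbert e_basis (sym_range_uniq m) (sym_range_setP m) Q_proj).
by apply: eq_bigr => i _; rewrite /sqcoef dot_shift_pow.
Qed.

(* As [2 * m < D], distinct blocks see [v] through disjoint sets of basis
   vectors, so Bessel's inequality bounds their total. *)
Lemma block_bessel (C : pred int) (F : {fset int}) v :
  {in C &, injective q} ->
  \sum_(j <- F | C j) rnorm (Q (shift_pow (q j * D%:Z) v)) ^+ 2 <= rnorm v ^+ 2.
Proof.
move=> Cq; rewrite -big_filter.
under eq_bigr do rewrite rnorm_proj_shift.
pose s := [seq (i - q j * D%:Z)%R | j <- [seq j <- F | C j], i <- sym_range m].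
suff s_uniq : uniq s.
  by have := bessel H_hilbert e_basis v s_uniq; rewrite big_allpairs_dep.
apply: allpairs_uniq_dep => [|j _|].
- by rewrite filter_uniq ?fset_uniq.
- exact: sym_range_uniq.
move=> _ _ /allpairsPdep[j [i [jF im ->]]] /allpairsPdep[j' [i' [jF' im' ->]]] /= ji.
move: im im' jF jF'; rewrite !mem_sym_range !mem_filter => im im' /andP[Cj _] /andP[Cj' _].
have qq : q j = q j'.
  apply/eqP; rewrite eq_le !leNgt; apply/andP; split; apply/negP => lt_q.
    have := ler_wpM2r (_ : 0 <= D%:Z) (_ : q j' + 1 <= q j); rewrite mulrDl; lia.
  have := ler_wpM2r (_ : 0 <= D%:Z) (_ : q j + 1 <= q j'); rewrite mulrDl; lia.
have jj : j = j' by apply: Cq.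
by subst j'; congr existT; lia.
Qed.

Lemma sqsum_block_le (B : int -> bop H) (F : {fset int}) (delta : R) v :
  (forall j, j \in F -> (a j < K)%N -> rnorm (B j * Q) <= delta) ->
  sqsum F (block_seq B) v <= K%:R * delta ^+ 2 * rnorm v ^+ 2.
Proof.
move=> Bd; pose f j := rnorm (Q (shift_pow (q j * D%:Z) v)) ^+ 2.
have : sqsum F (block_seq B) v <= \sum_(j <- F | (a j < K)%N) delta ^+ 2 * f j.
  rewrite /sqsum [leRHS]big_mkcond !big_seq; apply: ler_sum => j jF.
  rewrite /block_seq; case: ifP => [ajK|_]; last by rewrite rnorm0 expr0n.
  pose w := shift_pow (q j * D%:Z) v.
  have -> : (B j * Q * shift_pow (q j * D%:Z)) v = (B j * Q) (Q w).
    by rewrite !bop_mulE (proj_idem H_hilbert e_basis (sym_range_uniq m) (sym_range_setP m) Q_proj).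
  rewrite /f -/w -exprMn ler_pXn2r ?nnegrE ?rnorm_ge0 //.
    by rewrite (le_trans (rnorm_bop _ _)) // ler_wpM2r ?rnorm_ge0 ?Bd.
  by rewrite mulr_ge0 ?rnorm_ge0 // (le_trans (rnorm_ge0 _) (Bd _ jF ajK)).
move=> /le_trans; apply; rewrite -mulr_sumr -mulrA mulrCA.
rewrite ler_wpM2l ?sqr_ge0 //.
case: (posnP K) => [->|K0]; first by rewrite big_pred0 // mul0r.
pose p j : 'I_K := insubd (Ordinal K0) (a j).
rewrite (partition_big p xpredT) //=.
have -> : K%:R * rnorm v ^+ 2 = \sum_(i < K) rnorm v ^+ 2.
  by rewrite mulr_natl sumr_const card_ord.
apply: ler_sum => i _; apply: (block_bessel (C := fun j => (a j < K)%N && (p j == i))).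
move=> j j' /andP[aj /eqP pj] /andP[aj' /eqP pj']; apply: aq_inj.
have := congr1 val pj; have := congr1 val pj'.
by rewrite !val_insubd aj aj' => -> ->.
Qed.

Lemma l2_tail_block (B : int -> bop H) :
  (forall delta : R, 0 < delta -> exists F : {fset int}, forall j, j \notin F ->
     (a j < K)%N -> rnorm (B j * Q) <= delta) ->
  l2_tail (block_seq B).
Proof.
move=> Bd eps eps0.
have K1 : 0 < K.+1%:R :> R by rewrite ltr0n.
have d0 : 0 < Num.sqrt (eps / K.+1%:R) by rewrite sqrtr_gt0 divr_gt0.
have [F FB] := Bd _ d0; exists F => E v FE v1.
have := @sqsum_block_le B E (Num.sqrt (eps / K.+1%:R)) v.
move=> /(_ _)/le_trans; apply.
  move=> j jE; apply: FB; move/fdisjointP_sym: FE; exact.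
rewrite sqr_sqrtr ?divr_ge0 ?(ltW eps0) ?ler0n //.
have : rnorm v ^+ 2 <= 1 by rewrite expr_le1 ?rnorm_ge0.
have : K%:R * (eps / K.+1%:R) <= eps.
  rewrite mulrCA ler_piMr ?(ltW eps0) // ler_pdivrMr // mul1r ler_nat //.
have := sqr_ge0 (rnorm v); have : 0 <= K%:R * (eps / K.+1%:R).
  by rewrite mulr_ge0 ?divr_ge0 ?ler0n ?(ltW eps0).
by move: (K%:R * _) => Z; nra.
Qed.

End Blocks.
End BilateralShift.

(** * Periodic elements *)

Lemma uniform_eventually (T : eqType) (s : seq T) (P : T -> nat -> Prop) :
  (forall r, r \in s -> exists N, forall n, (N <= n)%N -> P r n) ->
  exists N, forall r, r \in s -> forall n, (N <= n)%N -> P r n.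
Proof.
elim: s => [|t s IH] Ps; first by exists 0%N.
have [N NP] := Ps t (mem_head _ _).
have [r rs|N' NP'] := IH; first by apply: Ps; rewrite inE rs orbT.
exists (maxn N N') => r; rewrite inE => /predU1P[->|rs] n; rewrite geq_max => /andP[].
  by move=> /NP.
by move=> _; exact: NP'.
Qed.

Lemma mem_sym_fset m (i : int) :
  (i \in [fset j in sym_range m]%fset) = (- m%:Z <= i <= m%:Z).
Proof. by rewrite in_fset -mem_sym_range. Qed.

Lemma fset_int_bounded (F : {fset int}) :
  exists B : nat, forall j, j \in F -> (absz j <= B)%N.
Proof.
exists (\max_(j <- F) absz j)%N => j jF.
exact: (@leq_bigmax_seq _ (enum_fset F) predT (fun j => absz j) j jF).
Qed.

Section PeriodicElements.
Variables (R : realType) (H : completeNormedModType R[i]).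
Variable dot : {dot H for Num.conj}.
Variables (e : int -> H) (P : nat -> bop H) (U : bop H) (W Winv G G' : int -> bop H).
Hypotheses (H_hilbert : hilbert_norm dot) (e_basis : orthonormal_basis dot e).
Hypothesis P_proj : forall m : nat, (0 < m)%N ->
  orthogonal_projection dot (P m) (span_of e [set j : int | (- m%:Z <= j <= m%:Z)%R]).
Hypotheses (U_unitary : unitary_op dot U)
  (U_shift : forall j : int, U (e j) = e (j + 1)).
Hypothesis W_inv : forall j : int, W j * Winv j = 1 /\ Winv j * W j = 1.
Hypotheses (GG' : forall j, G j * G' j = 1) (G'G : forall j, G' j * G j = 1)
  (GW : forall j, G j = W j * G (j - 1)).

Local Notation T := (weighted_shift dot U W).

Lemma l2CP x : l2C dot x <-> (forall j, compact_operator (x j)) /\ l2_tail x.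
Proof. by split=> -[xK /(cvg_gramP H_hilbert)]. Qed.

Lemma periodic_tail_sup x (m : nat) : (0 < m)%N -> periodic_elements dot T x ->
  exists d : nat, [/\ (0 < d)%N, (2 * m < d)%N & forall r : int,
    tail_sup_cvg0 (fun n => prod_above W r (n * d) * x r * P m) /\
    tail_sup_cvg0 (fun n => prod_below Winv r (n * d) * x r * P m)].
Proof.
move=> m0 [/l2CP[_ xt] [d d0 xd]].
have dm : (2 * m < d * (2 * m).+1)%N by exact: leq_pmull.
exists (d * (2 * m).+1)%N; split=> [|//|r]; first exact: leq_ltn_trans dm.
have per n j : (0 < n)%N ->
    x j = G j * G' (j - (n * (d * (2 * m).+1))%:Z)
      * x (j - (n * (d * (2 * m).+1))%:Z) * U ^+ (n * (d * (2 * m).+1)).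
  move=> n0; rewrite -(iter_weighted_shift U_unitary _ _ _ GG' G'G GW).
  by rewrite [(d * _)%N]mulnC mulnA xd // muln_gt0 n0.
have P1 (A : bop H) (eps : R) : rnorm A <= eps -> rnorm (A * P m) <= eps.
  move=> Ae; rewrite (le_trans _ Ae) // opnorm_le // => v v1.
  rewrite (le_trans (rnorm_bop A _)) // ler_piMr ?rnorm_ge0 // (le_trans _ v1) //.
  exact: (rnorm_proj_le H_hilbert e_basis (sym_range_uniq m) (sym_range_setP m) (P_proj m0)).
have escape (F : {fset int}) : exists N, forall n, (N <= n)%N ->
    [/\ (0 < n)%N, r + (n * (d * (2 * m).+1))%:Z \notin F
      & r - (n * (d * (2 * m).+1))%:Z \notin F].
  have [B BF] := fset_int_bounded F.
  exists (B + absz r).+1 => n nN.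
  have nd : (n <= n * (d * (2 * m).+1))%N by rewrite leq_pmulr // (leq_ltn_trans _ dm).
  split; first by lia.
    by apply/negP => /BF; lia.
  by apply/negP => /BF; lia.
split; apply/tail_sup_cvg0P => eps eps0; have [F FP] := l2_tail_entry xt eps0;
  have [N NP] := escape F; exists N => n /NP[n0 aF bF]; apply: P1.
- have -> : prod_above W r (n * (d * (2 * m).+1)) * x r =
      x (r + (n * (d * (2 * m).+1))%:Z) * adjoint dot U ^+ (n * (d * (2 * m).+1)).
    rewrite (prod_above_gauge GG' GW) [X in _ = X * _](per n) // addrK.
    by rewrite -!mulrA unitary_powK // mulr1.
  rewrite (le_trans _ (FP _ aF)) // opnorm_le // => v v1.
  rewrite bop_mulE (le_trans (rnorm_bop _ _)) // ler_piMr ?rnorm_ge0 //.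
  exact: le_trans (rnorm_adjoint_pow_le H_hilbert U_unitary _ _) v1.
have -> : prod_below Winv r (n * (d * (2 * m).+1)) * x r =
    x (r - (n * (d * (2 * m).+1))%:Z) * U ^+ (n * (d * (2 * m).+1)).
  rewrite (prod_below_gauge W_inv GG' GW) [X in _ * X = _](per n) //.
  by rewrite !mulrA -(mulrA (G _) (G' r)) G'G mulr1 GG' mul1r.
rewrite (le_trans _ (FP _ bF)) // opnorm_le // => v v1.
rewrite bop_mulE (le_trans (rnorm_bop _ _)) // ler_piMr ?rnorm_ge0 //.
by rewrite (rnorm_unitary_pow H_hilbert).
Qed.

Lemma gauge_decay x (J d : nat) (Q : bop H) :
  (forall r : int, (- J%:Z <= r <= J%:Z)%R ->
    tail_sup_cvg0 (fun n => prod_above W r (n * d) * x r * Q) /\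
    tail_sup_cvg0 (fun n => prod_below Winv r (n * d) * x r * Q)) ->
  forall delta : R, 0 < delta -> exists N : nat, forall k r : int,
    (N <= absz k)%N -> (- J%:Z <= r <= J%:Z)%R ->
    rnorm (G (r + k * d%:Z) * G' r * x r * Q) <= delta.
Proof.
move=> xJ delta delta0.
have [r|N NP] := @uniform_eventually _ (sym_range J) (fun r n =>
    rnorm (G (r + (n * d)%:Z) * G' r * x r * Q) <= delta /\
    rnorm (G (r - (n * d)%:Z) * G' r * x r * Q) <= delta).
  rewrite mem_sym_range => /xJ[/tail_sup_cvg0P/(_ _ delta0)[N NP]].
  move=> /tail_sup_cvg0P/(_ _ delta0)[N' NP'].
  exists (maxn N N') => n; rewrite geq_max => /andP[/NP + /NP'].
  by rewrite (prod_above_gauge GG' GW) (prod_below_gauge W_inv GG' GW).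
exists N => k r Nk rJ; have [] := NP r _ _ Nk; first by rewrite mem_sym_range.
case: (leP 0 k) => k0.
  by have -> : k * d%:Z = (absz k * d)%:Z by rewrite PoszM; congr (_ * _); lia.
move=> _; have -> // : k * d%:Z = - (absz k * d)%:Z.
by rewrite PoszM -mulNr; congr (_ * _); lia.
Qed.

Section PeriodicExtension.
Variables (x : int -> bop H) (J m d N : nat) (eta : R).
Hypotheses (x_l2 : l2C dot x) (m0 : (0 < m)%N) (Jm : (J <= m)%N) (md : (2 * m < d)%N)
  (N0 : (0 < N)%N).
Let D := (N * d)%N.
Let a (j : int) : nat := absz ((j + J%:Z) %% D%:Z)%Z.
Let q (j : int) : int := ((j + J%:Z) %/ D%:Z)%Z.
Let K := (2 * J).+1.
Let res (j : int) : int := j - q j * D%:Z.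

(* The sum of the [T^(k * D)], [k : int], applied to [x_r P_m], [|r| <= J]: the orbit
   of the entry [r] fills the indices [j] with [res j = r], [q j] being [k].  Since
   [2 * J < D], no two orbits meet. *)
Definition periodic_extension : int -> bop H :=
  block_seq dot U D K (P m) a q (fun j => G j * G' (res j) * x (res j)).

Let mD : (2 * m < D)%N.
Proof. by rewrite (leq_trans md) // leq_pmull. Qed.

Let D_neq0 : D%:Z != 0.
Proof. by move: mD; lia. Qed.

Let resE j : res j = (a j)%:Z - J%:Z.
Proof.
rewrite /res /a gez0_abs ?modz_ge0 // /q.
have := divz_eq (j + J%:Z) D%:Z; lia.
Qed.

Let aq_inj j j' : a j = a j' -> q j = q j' -> j = j'.
Proof. by move=> aj qj; have := resE j; rewrite aj -resE /res qj; lia. Qed.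

Let res_range j : (a j < K)%N -> - J%:Z <= res j <= J%:Z.
Proof. rewrite resE /K; lia. Qed.

Let aD n j : a (j - (n * D)%:Z) = a j.
Proof.
rewrite /a; have -> : j - (n * D)%:Z + J%:Z = - n%:Z * D%:Z + (j + J%:Z) by lia.
by rewrite modzMDl.
Qed.

Let qD n j : q (j - (n * D)%:Z) = q j - n%:Z.
Proof.
rewrite /q; have -> : j - (n * D)%:Z + J%:Z = - n%:Z * D%:Z + (j + J%:Z) by lia.
by rewrite divzMDl // addrC.
Qed.

Let q0P j : reflect ((a j < K)%N /\ q j = 0) (- J%:Z <= j <= J%:Z).
Proof.
have JD : 2 * J%:Z < D%:Z by move: mD Jm; lia.
apply: (iffP idP) => [jJ|[aj qj]].
  have jD : 0 <= j + J%:Z < `|D%:Z| by lia.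
  have qj : q j = 0 by rewrite /q divz_small.
  split=> //; have := resE j; rewrite /res qj /K; lia.
by have := res_range aj; rewrite /res qj mul0r subr0.
Qed.

Lemma periodic_extension_iter n : iter (n * D) T periodic_extension = periodic_extension.
Proof.
apply/funext => j; rewrite (iter_weighted_shift U_unitary _ _ _ GG' G'G GW).
rewrite /periodic_extension /block_seq aD; case: ifP => aj; last by rewrite mulr0 mul0r.
have -> : res (j - (n * D)%:Z) = res j by rewrite /res qD; lia.
rewrite !mulrA -(mulrA (G j)) G'G mulr1 -mulrA shift_powD //.
by rewrite qD; congr (_ * shift_pow dot U _); lia.
Qed.

Lemma periodic_extension_periodic :
  (forall delta : R, 0 < delta -> exists N' : nat, forall k r : int,
    (N' <= absz k)%N -> (- J%:Z <= r <= J%:Z)%R ->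
    rnorm (G (r + k * d%:Z) * G' r * x r * P m) <= delta) ->
  periodic_elements dot T periodic_extension.
Proof.
move=> decay; split; last first.
  exists D; first exact: leq_ltn_trans mD.
  by move=> n _; exact: periodic_extension_iter.
apply/l2CP; split=> [j|].
  rewrite /periodic_extension /block_seq; case: ifP => _; last exact: compact_operator0.
  do 2 apply: compact_operatorMr; apply: compact_operatorMl.
  by have /l2CP[] := x_l2.
apply: (l2_tail_block H_hilbert U_unitary U_shift e_basis mD (P_proj m0) aq_inj).
move=> delta /decay[N' NP'].
exists [fset j in sym_range (J + N' * D)]%fset => j; rewrite mem_sym_fset => jF aj.
have rj := res_range aj.
have -> : j = res j + q j * N%:Z * d%:Z.
  by rewrite -mulrA -PoszM /res subrK.
have -> : res (res j + q j * N%:Z * d%:Z) = res j.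
  by rewrite -mulrA -PoszM /res subrK.
apply: NP' => //; rewrite abszM.
suff qN : (N' <= absz (q j))%N by rewrite (leq_trans qN) // leq_pmulr.
rewrite leqNgt; apply/negP => qN; move/negP: jF; apply.
have jE : j = res j + q j * D%:Z by rewrite /res subrK.
have qD1 : (absz (q j * D%:Z)%R <= N' * D)%N by rewrite abszM leq_mul // ltnW.
by lia.
Qed.

Lemma periodic_extension_dist (delta : R) (F : {fset int}) v :
  K%:R * delta ^+ 2 <= eta ->
  (forall k r : int, (N <= absz k)%N -> (- J%:Z <= r <= J%:Z)%R ->
    rnorm (G (r + k * d%:Z) * G' r * x r * P m) <= delta) ->
  (forall j, j \in sym_range J -> K%:R * rnorm (x j - x j * P m) ^+ 2 <= eta) ->
  (forall (E : {fset int}) u, [disjoint [fset j in sym_range J] & E]%fset ->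
    rnorm u <= 1 -> sqsum E x u <= eta) ->
  rnorm v <= 1 ->
  sqsum F (fun j => x j - periodic_extension j) v <= 6 * eta.
Proof.
move=> deltaK decay xP xtail v1; set S := [fset j in sym_range J]%fset in xtail.
have v2 : rnorm v ^+ 2 <= 1 by rewrite expr_le1 ?rnorm_ge0.
have eta0 : 0 <= eta by rewrite (le_trans _ deltaK) // mulr_ge0 ?sqr_ge0.
pose z j := if j \in sym_range J then x j * P m else 0.
have yz : sqsum F (fun j => periodic_extension j - z j) v <= eta.
  pose B j := if q j == 0 then 0 else G j * G' (res j) * x (res j).
  have -> : sqsum F (fun j => periodic_extension j - z j) v =
      sqsum F (block_seq dot U D K (P m) a q B) v.
    apply: eq_bigr => j _; rewrite /periodic_extension /block_seq /z /B.
    rewrite mem_sym_range.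
    case: q0P => [[aj qj]|nj].
      by rewrite aj qj eqxx /res qj !mul0r subr0 GG' mul1r mulr1 subrr.
    case: ifP => aj; last by rewrite subr0.
    by case: eqP => [qj|_]; [case: nj|rewrite subr0].
  apply: le_trans (sqsum_block_le H_hilbert U_unitary U_shift e_basis mD (P_proj m0)
    aq_inj (delta := delta) _ _) _ => [j _ aj|].
    rewrite /B; case: eqP => [_|/eqP qj].
      rewrite mul0r rnorm0.
      by apply: le_trans (rnorm_ge0 _) (decay N 0 _ _); lia.
    have -> : G j = G (res j + q j * N%:Z * d%:Z).
      by rewrite -mulrA -PoszM /res subrK.
    apply: decay; last exact: res_range.
    by rewrite abszM leq_pmull // absz_gt0.
  rewrite (le_trans _ deltaK) // ler_piMr // mulr_ge0 ?sqr_ge0 //.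
have xz : sqsum F (fun j => x j - z j) v <= 2 * eta.
  rewrite (le_trans (sqsum_subset _ _ (fsubsetUr S F))) //.
  rewrite /sqsum (big_fset_diff _ (fsubsetUl S F)) mulr2n mulrDl mul1r lerD //.
    apply: le_trans (_ : \sum_(j <- sym_range J) eta / K%:R <= _).
      rewrite (perm_big (sym_range J)) /=; last first.
        apply: uniq_perm (fset_uniq S) (sym_range_uniq J) _ => j.
        by rewrite mem_sym_fset mem_sym_range.
      rewrite big_seq [leRHS]big_seq; apply: ler_sum => j jJ.
      rewrite /z jJ ler_pdivlMr ?ltr0n // mulrC.
      apply: le_trans (xP j jJ); rewrite ler_wpM2l ?ler0n //.
      rewrite ler_pXn2r ?nnegrE ?rnorm_ge0 //.
      by rewrite (le_trans (rnorm_bop (x j - x j * P m) v)) // ler_piMr ?rnorm_ge0.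
    rewrite big_const_seq count_predT iter_addr addr0 size_map size_iota.
    by rewrite -[_ *+ _]mulr_natr divfK ?pnatr_eq0.
  have SE : [disjoint S & (S `|` F) `\` S]%fset.
    by apply/fdisjointP => j jS; rewrite inE jS.
  apply: le_trans (xtail _ v SE v1); rewrite le_eqVlt; apply/orP; left; apply/eqP.
  apply: eq_big_seq => j; rewrite in_fsetD mem_sym_fset /z mem_sym_range => /andP[/negbTE -> _].
  by rewrite subr0.
have := sqsumB_le H_hilbert F (fun j => x j - z j) (fun j => periodic_extension j - z j) v.
have -> : (fun j => x j - z j - (periodic_extension j - z j)) =
    (fun j => x j - periodic_extension j).
  by apply/funext => j; rewrite opprB addrA subrK.
lra.
Qed.

End PeriodicExtension.

Lemma tail_sup_dense (D : set (int -> bop H)) : l2_dense dot D ->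
  (forall J m : nat, (0 < J)%N -> (0 < m)%N ->
     forall x : int -> bop H, D x ->
     exists d : nat, [/\ (0 < d)%N, (2 * m < d)%N &
       forall r : int, (- J%:Z <= r <= J%:Z)%R ->
         tail_sup_cvg0 (fun n => prod_above W r (n * d) * x r * P m) /\
         tail_sup_cvg0 (fun n => prod_below Winv r (n * d) * x r * P m)]) ->
  l2_dense dot (periodic_elements dot T).
Proof.
move=> [Dl2 Dd] Dt; split=> [x []//|b b_l2 eps eps0].
have e8 : 0 < eps / 8 by rewrite divr_gt0.
pose eta := (eps / 8) ^+ 2; have eta0 : 0 < eta by rewrite exprn_gt0.
have [x Dx xb] := Dd b b_l2 _ e8.
have x_l2 := Dl2 _ Dx; have /l2CP[xK xt] := x_l2; have /l2CP[_ bt] := b_l2.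
have [F xF] := xt _ eta0; have [J0 FJ0] := fset_int_bounded F.
pose J := J0.+1; pose K := (2 * J).+1.
have K0 : 0 < K%:R :> R by rewrite ltr0n.
have xtail (E : {fset int}) u : [disjoint [fset j in sym_range J] & E]%fset ->
    rnorm u <= 1 -> sqsum E x u <= eta.
  move=> JE; apply: xF; apply: fdisjointWl JE; apply/fsubsetP => j /FJ0 jJ.
  by rewrite mem_sym_fset; lia.
pose delta := Num.sqrt (eta / K%:R).
have delta0 : 0 < delta by rewrite sqrtr_gt0 divr_gt0.
have deltaK : K%:R * delta ^+ 2 <= eta.
  by rewrite sqr_sqrtr ?divr_ge0 ?(ltW eta0) // mulrC divfK ?gt_eqF.
have [j _|M MP] := @uniform_eventually _ (sym_range J) (fun j n =>
    rnorm (x j - x j * P n.+1) <= delta).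
  have [M MP] := compact_proj_cvg H_hilbert e_basis P_proj (xK j) delta0.
  by exists M => n Mn; exact: MP.
pose m := (maxn M J).+1; have m0 : (0 < m)%N by [].
have xP j : j \in sym_range J -> K%:R * rnorm (x j - x j * P m) ^+ 2 <= eta.
  move=> jJ; apply: le_trans deltaK; rewrite ler_wpM2l ?ler0n //.
  by rewrite ler_pXn2r ?nnegrE ?rnorm_ge0 ?(ltW delta0) // MP // leq_maxl.
have Jm : (J <= m)%N by rewrite leqW // leq_maxr.
have [d [d0 md /gauge_decay decay]] := Dt J m isT isT x Dx.
have [N NP] := decay _ delta0.
pose y := periodic_extension x J m d N.+1.
have y_per : periodic_elements dot T y by exact: periodic_extension_periodic.
exists y => //; have /l2CP[_ yt] := y_per.1.
have e2 : 0 <= eps / 2 by rewrite divr_ge0 ?(ltW eps0).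
apply: le_lt_trans (_ : eps / 2 < eps); last by lra.
apply: l2norm_le => //; first exact: l2_tailB.
move=> E v v1.
have xbE : sqsum E (fun j => x j - b j) v <= eta.
  rewrite (le_trans (sqsum_le_l2norm H_hilbert _ (l2_tailB H_hilbert xt bt) v1)) //.
  by rewrite ler_pXn2r ?nnegrE ?sqrtr_ge0 ?(ltW e8) // ltW.
have xyE : sqsum E (fun j => x j - y j) v <= 6 * eta.
  apply: (periodic_extension_dist m0 Jm md (ltn0Sn N) _ deltaK) => // k r Nk.
  by apply: NP; exact: ltnW.
have := sqsumB_le H_hilbert E (fun j => x j - b j) (fun j => x j - y j) v.
have -> : (fun j => x j - b j - (x j - y j)) = (fun j => y j - b j).
  by apply/funext => j; rewrite opprB addrC addrA subrK.
have -> : (eps / 2) ^+ 2 = 16 * eta by rewrite /eta !exprMn !exprVn; field.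
lra.
Qed.

End PeriodicElements.

Theorem theorem3p4 (R : realType) (H : completeNormedModType R[i])
    (dot : {dot H for Num.conj}) (e : int -> H) (P : nat -> bop H)
    (U : bop H) (W Winv : int -> bop H)
    (H_hilbert : hilbert_norm dot)
    (e_basis : orthonormal_basis dot e)
    (P_proj : forall m : nat, (0 < m)%N ->
       orthogonal_projection dot (P m)
         (span_of e [set j : int | (- m%:Z <= j <= m%:Z)%R]))
    (U_unitary : unitary_op dot U)
    (U_shift : forall j : int, U (e j) = e (j + 1))
    (W_inv : forall j : int, W j * Winv j = 1 /\ Winv j * W j = 1)
    (W_bounded : exists M : R, forall j : int, rnorm (W j) <= M)
    (Winv_bounded : exists M : R, forall j : int, rnorm (Winv j) <= M) :
  l2_dense dot (periodic_elements dot (weighted_shift dot U W))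
  <->
  (exists D : set (int -> bop H), l2_dense dot D /\
     forall J m : nat, (0 < J)%N -> (0 < m)%N ->
     forall x : int -> bop H, D x ->
     exists d : nat, [/\ (0 < d)%N, (2 * m < d)%N &
       forall r : int, (- J%:Z <= r <= J%:Z)%R ->
         tail_sup_cvg0 (fun n => prod_above W r (n * d) * x r * P m) /\
         tail_sup_cvg0 (fun n => prod_below Winv r (n * d) * x r * P m)]).
Proof.
have [G [G' [GG' G'G GW]]] := gauge_exists W_inv.
split=> [T_dense|[D [D_dense Dt]]].
  exists (periodic_elements dot (weighted_shift dot U W)); split=> //.
  move=> J m _ m0 x xT.
  have [d [d0 md xd]] := periodic_tail_sup H_hilbert e_basis P_proj U_unitary W_inv
    GG' G'G GW m0 xT.
  by exists d; split=> // r _; exact: xd.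
exact: (tail_sup_dense H_hilbert e_basis P_proj U_unitary U_shift W_inv GG' G'G GW D_dense).
Qed.
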